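(* Let $\mathbf{X}$ be an $M$-digging random walk with bias $\lambda$ ($M$-DRW$_\lambda$) on an infinite, locally finite, rooted tree $\mathcal{T}=(V,E)$ with root $\varrho$, with parameters $\lambda>0$ and $\overline{M}=(m_\nu;\nu\in V)\in\mathbb{N}^V$ (where $\mathbb{N}=\{0,1,2,\dots\}$ and $m_\varrho=0$). If $RT(\mathcal{T},\psi_{M,\lambda})<1$ then $\mathbf{X}$ is recurrent. If $RT(\mathcal{T},\psi_{M,\lambda})>1$ and if there exists $M\in\mathbb{N}$ such that $\sup_{\nu\in V}m_\nu\le M$, then $\mathbf{X}$ is transient.
   Context: Tree notation: $|\nu|$ is the graph distance from $\nu\in V$ to $\varrho$; each edge $e$ has endpoints $e^-,e^+$ with $|e^+|=|e^-|+1$, and $|e|:=|e^+|$. For edges, $g\le e$ means that $g^+$ lies on the self-avoiding path from $\varrho$ to $e^+$. A cutset is a set $\pi$ of edges such that every infinite self-avoiding path $(\nu_i)_{i\ge 0}$ started at $\varrho$ has exactly one $i\ge1$ with $[\nu_{i-1},\nu_i]\in\pi$; $\Pi$ is the set of cutsets. For $\psi:E\to\mathbb{R}^+$, $$RT(\mathcal{T},\psi)=\sup\Big\{\gamma>0:\ \inf_{\pi\in\Pi}\sum_{e\in\pi}\Big(\prod_{g\le e}\psi(g)\Big)^{\gamma}>0\Big\}\qquad(\sup\emptyset=0).$$ The function $\psi_{M,\lambda}$ is $\psi_{M,\lambda}(e)=1$ if $|e|=1$ and, for $|e|>1$, $$\psi_{M,\lambda}(e)=\Big(\frac{\lambda^{|e|-1}-1}{\lambda^{|e|}-1}\Big)^{m_{e^+}+1}\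 \text{if }\lambda\ne1,\qquad \psi_{M,\lambda}(e)=\Big(\frac{|e|-1}{|e|}\Big)^{m_{e^+}+1}\ \text{if }\lambda=1.$$ $M$-DRW$_\lambda$: given $\lambda>0$ and non-negative integers $(m_\nu)_{\nu\in V}$ with $m_\varrho=0$, the walk $\mathbf{X}=(X_n)_{n\ge0}$ starts at $X_0=\varrho$. Let $\ell_n(\nu)=|\{k\in\{0,\dots,n\}:X_k=\nu\}|$ and $$W_n(e)=\big(1-\mathbf{1}_{\{\ell_n(e^-)\le m_{e^-}\}}\big)\lambda^{-|e|+1}.$$ On $\{X_n=\nu\}$, for $\mu\sim\nu$, $$\mathbb{P}(X_{n+1}=\mu\mid X_0,\dots,X_n)=\frac{W_n([\nu,\mu])}{\sum_{\mu'\sim\nu}W_n([\nu,\mu'])}.$$ Recurrence/transience: let $\sigma_0=0$, $\sigma_{n+1}=\inf\{k>\sigma_n: X_k\ne X_{\sigma_n},\ \ell_k(X_k)\ge m_{X_k}+1\}$, $\widetilde X_n=X_{\sigma_n}$, and $T(\varrho)=\inf\{k\ge1:\widetilde X_k=\varrho\}$. The walk $\mathbf{X}$ is transient if $\mathbb{P}(T(\varrho)=\infty)>0$, and recurrent otherwise. *)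

(* Defs.v *)
From HB Require Import structures.
From mathcomp Require Import all_boot all_order all_algebra.
From mathcomp Require Import all_classical all_reals all_analysis.

Set Implicit Arguments.
Unset Strict Implicit.
Unset Printing Implicit Defensive.

Import Order.TTheory GRing.Theory Num.Theory.

Local Open Scope classical_set_scope.
Local Open Scope ring_scope.

(* Taking a [choiceType] of vertices is no restriction: with the classical
   axioms in use every type carries such a structure. *)
Record rootedTree := RootedTree {
  vertex :> choiceType ;
  adj : rel vertex ;
  troot : vertex ;
  adj_sym : symmetric adj ;
  adj_irr : irreflexive adj ;
  adj_connected :
    forall x y : vertex, exists p : seq vertex, path adj x p /\ last x p = y ;
  adj_acyclic : forall c : seq vertex, ucycle adj c -> (size c <= 2)%N }.

Arguments adj {_} _ _.
Arguments troot {_}.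

Section Tree.
Variable T : rootedTree.

Definition locally_finite_tree := forall x : T, finite_set [set y | adj x y].

Fact gdist_subproof (x y : T) : exists n : nat,
  `[< exists p : seq T, [/\ path adj x p, last x p = y & size p = n] >].
Proof.
have [p [pp pl]] := adj_connected x y.
by exists (size p); apply/asboolP; exists p.
Qed.

Definition gdist (x y : T) : nat := ex_minn (gdist_subproof x y).

Definition depth (x : T) : nat := gdist troot x.

(* An edge e is represented by the pair (e^-, e^+). *)
Definition edges : set (T * T) :=
  [set e | adj e.1 e.2 /\ depth e.2 = (depth e.1).+1].

(* [x, y] for adjacent x and y (whose depths always differ by one) *)
Definition edge_of (x y : T) : T * T :=
  if (depth x < depth y)%N then (x, y) else (y, x).

Definition elevel (e : T * T) : nat := depth e.2.

Definition edge_le (g e : T * T) : Prop :=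
  exists p : seq T, [/\ path adj troot p, uniq (troot :: p), last troot p = e.2
                      & g.2 \in troot :: p].

Definition ray (nu : nat -> T) : Prop :=
  [/\ nu 0%N = troot, forall i, adj (nu i) (nu i.+1) & injective nu].

Definition cutset (pi : set (T * T)) : Prop :=
  pi `<=` edges /\
  forall nu, ray nu ->
    exists! i : nat, (1 <= i)%N /\ pi (edge_of (nu i.-1) (nu i)).

Variable R : realType.

(* Adjoining 0 to the set of exponents encodes sup set0 = 0. *)
Definition RT (psi : T * T -> R) : \bar R :=
  ereal_sup ([set 0%E] `|` [set gamma%:E | gamma in [set gamma : R |
    0 < gamma /\
    (0 < ereal_inf [set
       \esum_(e in pi)
         ((\big[*%R/1%R]_(g \in [set g | edges g /\ edge_le g e]) psi g)
            `^ gamma)%:E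
       | pi in cutset])%E]]).

Variables (lambda : R) (m : T -> nat).

Definition psiM (e : T * T) : R :=
  let n := elevel e in
  if n == 1%N then 1
  else if lambda != 1 then
    ((lambda ^+ n.-1 - 1) / (lambda ^+ n - 1)) ^+ (m e.2).+1
  else (n.-1%:R / n%:R) ^+ (m e.2).+1.

Definition local_time (x : nat -> T) (n : nat) (v : T) : nat :=
  #|[set k : 'I_n.+1 | x k == v]|.

(* [elevel e] is at least 1 on edges, so the last factor is
   lambda^(- |e| + 1). *)
Definition weight (x : nat -> T) (n : nat) (e : T * T) : R :=
  (1 - (local_time x n e.1 <= m e.1)%N%:R) * lambda ^- (elevel e).-1.

Section Walk.
Context {d : measure_display} {Omega : measurableType d}.
Variables (P : probability Omega R) (X : nat -> Omega -> T).

(* used only for conditioning events of positive probability *)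
Definition cond_prob (A B : set Omega) : R := fine (P (A `&` B)) / fine (P B).

(* the event that X_0, ..., X_n equal x 0, ..., x n *)
Definition history (n : nat) (x : nat -> T) : set Omega :=
  [set w | forall k, (k <= n)%N -> X k w = x k].

(* Each X_n takes values in the countable discrete set of vertices, so
   conditioning on X_0, ..., X_n is elementary conditioning on the
   histories of positive probability. *)
Definition digging_random_walk : Prop :=
  [/\ forall n v, measurable [set w | X n w = v],
      P [set w | X 0%N w = troot] = 1%E
    & forall n (x : nat -> T) (mu : T),
        (0 < P (history n x))%E -> adj (x n) mu ->
        cond_prob [set w | X n.+1 w = mu] (history n x) =
        weight x n (edge_of (x n) mu) /
        \sum_(mu' \in [set mu' | adj (x n) mu'])
           weight x n (edge_of (x n) mu')].

(* infimum of a set of naturals, with [None] standing for infinity *)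
Definition first_time (Q : pred nat) : option nat :=
  if pselect (exists n, Q n) is left h then Some (ex_minn h) else None.

Fixpoint sigma (x : nat -> T) (n : nat) : option nat :=
  if n is n'.+1 then
    if sigma x n' is Some s then
      first_time (fun k => [&& (s < k)%N, x k != x s
                             & (m (x k) + 1 <= local_time x k (x k))%N])
    else None
  else Some 0%N.

(* [None] when sigma_n is infinite *)
Definition extracted (x : nat -> T) (n : nat) : option T :=
  if sigma x n is Some s then Some (x s) else None.

Definition return_time (x : nat -> T) : option nat :=
  first_time (fun k => (1 <= k)%N && (extracted x k == Some troot)).

Definition transient : Prop :=
  (0 < P [set w | return_time (fun n => X n w) = None])%E.

Definition recurrent : Prop := ~ transient.

End Walk.
End Tree.

(* Main.v *)
Require Import Defs.
From HB Require Import structures.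
From mathcomp Require Import all_boot all_order all_algebra.
From mathcomp Require Import all_classical all_reals all_analysis.
From mathcomp Require Import zify ring lra.

(** An excursion of the walk away from the root is compared with walks on
    single lines. On the line from the root to [v], let [ratio u] be the
    probability that the biased walk started at the parent of [u] hits [u]
    before the root, and raise it to the number of times this still has to
    happen: the number of visits that are missing to dig [u], or one if [u] is
    dug but the walk is outside of the subtree at [u]. The product [potential]
    of these powers is a martingale for the walk on the line, and also for the
    walk on the tree, because excursions off the line leave it unchanged
    ([step_potential]). It starts at [Psi v], the product of the weights
    [psiM] along the line, and is one when [v] gets dug. Hence [v] is dug
    before the return to the root with probability at most [Psi v]
    ([expect_dug_le]), and with probability at least a positive multiple of
    [Psi v], minus the probability that the excursion is not over
    ([expect_dug_ge]).

    Recurrence is a first moment bound. If the branching-ruin number is less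
    than 1, some cutset has small total [Psi]. By König's lemma the walk
    cannot dig a vertex of some level [N] without digging one of the cutset,
    and it cannot for ever avoid both level [N] and the return to the root
    ([expect_confined]). So the probability of no return is small
    ([expect_not_returned_small]).

    Transience is a second moment bound. If the branching-ruin number exceeds
    1, then for some [g > 1] all cutsets have [Psi `^ g]-weight bounded below,
    and max-flow min-cut on the truncated trees provides flows to level [N]
    that are bounded by [Psi `^ g] and whose mass is bounded below. Two
    vertices [v] and [v'] with last common ancestor [b] are dug together with
    probability at most a constant times [Psi v * Psi v' / Psi b]
    ([expect_two_dug_le]): the product of three potentials, one for the stem
    up to [b] and one for each arm, is a supermartingale if the stem counts
    twice in the factors of the arms, and this doubling costs a bounded factor
    when [m] is bounded. The second moment of the flow-weighted number of dug
    vertices at level [N] is thus at most a constant times the energy of the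
    flow, which is finite uniformly in [N] because [g > 1] ([energy_le]). If
    the walk were recurrent, the lower bound for one vertex would make the
    first moment bounded below, and every level would be dug before the return
    with a probability bounded below ([dig_deep]); this contradicts the
    finiteness of the excursion ([expect_not_returned_not_small]).

    All these estimates are inductions on finite histories, for the operator
    [expect]; [p_past_event] identifies it with the law of the walk, and
    [return_time_None] expresses the return time through histories. *)

Set Implicit Arguments.
Unset Strict Implicit.
Unset Printing Implicit Defensive.

Import Order.TTheory GRing.Theory Num.Theory.

Local Open Scope classical_set_scope.
Local Open Scope ring_scope.

(** * Depth and parents in a rooted tree *)

Section TreeStructure.
Variable T : rootedTree.
Implicit Types (x y z u v w : T) (p : seq T).
Local Notation root := (@troot T).

Lemma gdist_le x y p : path adj x p -> last x p = y -> (gdist x y <= size p)%N.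
Proof.
rewrite /gdist; case: ex_minnP => k _ kmin pp pl.
by apply: kmin; apply/asboolP; exists p.
Qed.

Lemma gdistP x y :
  exists p, [/\ path adj x p, last x p = y & size p = gdist x y].
Proof. by rewrite /gdist; case: ex_minnP => k /asboolP. Qed.

Lemma depth_root : depth root = 0%N.
Proof. by apply/eqP; rewrite -leqn0; apply: (@gdist_le _ _ [::]). Qed.

Lemma depth_eq0 x : (depth x == 0)%N = (x == root).
Proof.
apply/eqP/eqP => [|->]; last exact: depth_root.
rewrite /depth; have [p [_ pl <-]] := gdistP root x.
by move/size0nil => p0; rewrite -pl p0.
Qed.

Lemma depth_gt0 x : (0 < depth x)%N = (x != root).
Proof. by rewrite lt0n depth_eq0. Qed.

Lemma depth_adj_le x y : adj x y -> (depth y <= (depth x).+1)%N.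
Proof.
move=> xy; rewrite {2}/depth; have [p [pp pl <-]] := gdistP root x.
rewrite -(size_rcons p y); apply: gdist_le; last by rewrite last_rcons.
by rewrite rcons_path pp pl.
Qed.

Lemma exists_parent y : y != root ->
  exists2 z, adj z y & depth y = (depth z).+1.
Proof.
rewrite -depth_gt0 => dy.
have [p [pp pl ps]] := gdistP root y.
case/lastP: p pp pl ps => [|p y'] pp pl ps; first by rewrite /depth -ps in dy.
rewrite last_rcons in pl; subst y'.
move: pp; rewrite rcons_path => /andP[pp zy].
exists (last root p) => //; apply/eqP; rewrite eqn_leq depth_adj_le //=.
rewrite /depth -ps size_rcons ltnS; exact: gdist_le.
Qed.

(** The root is its own parent, so that [par] can be iterated freely. *)
Definition par y : T :=
  if pselect (exists z, adj z y /\ depth y = (depth z).+1) is left h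
  then projT1 (cid h) else y.

Lemma parP y : y != root -> adj (par y) y /\ depth y = (depth (par y)).+1.
Proof.
move=> yr; rewrite /par; case: pselect => [h|[]]; first by case: cid.
by have [z] := exists_parent yr; exists z.
Qed.

Lemma adj_par y : y != root -> adj (par y) y.
Proof. by move/parP => []. Qed.

Lemma depth_par y : y != root -> depth y = (depth (par y)).+1.
Proof. by move/parP => []. Qed.

Lemma par_root : par root = root.
Proof.
by rewrite /par; case: pselect => // h; case: (h) => z []; rewrite depth_root.
Qed.

Lemma walk_to_root y : exists p, [/\ path adj y p, last y p = root &
  all (fun z => (depth z < depth y)%N) p].
Proof.
move: {2}(depth y) (erefl (depth y)) => n; elim: n y => [|n IH] y dy.
  by exists [::]; split => //; apply/eqP; rewrite -depth_eq0 dy.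
have yr : y != root by rewrite -depth_gt0 dy.
have [ay dp] := parP yr.
have [|p [pp pl pa]] := IH (par y); first by move: dp; rewrite dy => -[].
exists (par y :: p); split => //=; first by rewrite adj_sym ay.
rewrite dp leqnn /=; apply: sub_all pa => z /= h; exact: ltnW.
Qed.

(** Two distinct neighbours of [x] joined by a walk that avoids [x] would
    close up to a cycle of length at least 3. *)
Lemma neighbors_separated x a b p : adj x a -> adj x b -> path adj a p ->
  last a p = b -> x \notin a :: p -> a = b.
Proof.
move=> xa xb pp; case/shortenP: pp => q pq uq sq lq xn.
have xnq : x \notin a :: q.
  apply: contra xn; rewrite !inE => /orP[->//|/sq->]; exact: orbT.
have : ucycle adj (x :: a :: q).
  rewrite /ucycle cons_uniq xnq uq andbT /= rcons_path xa pq /= lq.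
  by rewrite adj_sym xb.
by move/adj_acyclic => /=; case: q lq {pq uq sq xnq} => [/= ->|].
Qed.

(** The walk through the root: apart from its endpoints it only visits
    vertices less deep than one of them, so it avoids any other vertex that is
    at least as deep as both. *)
Lemma join_below a b : exists p, [/\ path adj a p, last a p = b &
  forall x, x != a -> x != b -> (maxn (depth a) (depth b) <= depth x)%N ->
    x \notin a :: p].
Proof.
have [p [pp pl pa]] := walk_to_root a.
have [q [pq ql qa]] := walk_to_root b.
have qrev : path adj root (rev (belast b q)).
  rewrite -ql rev_path; apply: sub_path pq => u v; by rewrite adj_sym.
exists (p ++ rev (belast b q)).
have lst : last root (rev (belast b q)) = b.
  by case: q ql {pq qa qrev} => [<-//|c q] ql; rewrite /= rev_cons last_rcons.
have memq z : z \in rev (belast b q) -> z = b \/ (depth z < depth b)%N.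
  rewrite mem_rev => /mem_belast; rewrite inE => /orP[/eqP->|zq]; [by left|].
  by right; exact: (allP qa).
split.
- by rewrite cat_path pp pl.
- by rewrite last_cat pl.
- move=> x xa xb xd; rewrite inE mem_cat negb_or xa /= negb_or.
  move: xd; rewrite geq_max => /andP[xda xdb].
  apply/andP; split; apply/negP.
    by move/(allP pa); rewrite ltnNge xda.
  by case/memq => [/eqP|]; rewrite ?(negPf xb) // ltnNge xdb.
Qed.

(** Otherwise [y] and the parent of [x] would be two neighbours of [x] joined
    by a walk through the root that avoids [x]. *)
Lemma depth_adj_neq x y : adj x y -> depth x != depth y.
Proof.
move=> xy; apply/eqP => dxy.
have xr : x != root.
  apply/eqP => xr; move: xy; rewrite xr.
  have -> : y = root by apply/eqP; rewrite -depth_eq0 -dxy xr depth_root.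
  by rewrite adj_irr.
have [ax dx] := parP xr.
have [p [pp pl pn]] := join_below (par x) y.
have xy' : x != y by apply/eqP => e; move: xy; rewrite e adj_irr.
have xpx : x != par x by apply/eqP => e; move: dx; rewrite -e; lia.
have : par x = y.
  apply: (@neighbors_separated x) pp pl _; rewrite ?xy // 1?adj_sym //.
  by apply: pn => //; rewrite geq_max -dxy leqnn andbT dx.
by move=> e; move: dx; rewrite e dxy; lia.
Qed.

Lemma unique_parent x a : adj a x -> depth x = (depth a).+1 -> a = par x.
Proof.
move=> ax da.
have xr : x != root by rewrite -depth_gt0 da.
have [px dx] := parP xr.
have [p [pp pl pn]] := join_below a (par x).
apply: (@neighbors_separated x) pp pl _; rewrite ?[adj x _]adj_sym //.
apply: pn; rewrite ?geq_max.
- by apply/eqP => e; move: da; rewrite -e; lia.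
- by apply/eqP => e; move: dx; rewrite -e; lia.
- by apply/andP; split; lia.
Qed.

Lemma adjP x y : adj x y ->
  (y != root /\ x = par y) \/ (x != root /\ y = par x).
Proof.
move=> xy; have yx : adj y x by rewrite adj_sym.
have dn := depth_adj_neq xy.
have d1 := depth_adj_le xy; have d2 := depth_adj_le yx.
have [dxy|dxy] := ltnP (depth x) (depth y).
  have e : depth y = (depth x).+1 by lia.
  by left; split; [rewrite -depth_gt0 e|exact: unique_parent].
have e : depth x = (depth y).+1 by lia.
by right; split; [rewrite -depth_gt0 e|exact: unique_parent].
Qed.

Lemma par_neq x : x != root -> par x != x.
Proof. by move=> /depth_par dx; apply/eqP => e; move: dx; rewrite e; lia. Qed.

Lemma edgesP e : edges e <-> e.2 != root /\ e.1 = par e.2.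
Proof.
split=> [[a d]|[er e1]].
  by split; [rewrite -depth_gt0 d|exact: unique_parent].
by split; rewrite e1; have [] := parP er.
Qed.

(** * Ancestors *)

Definition anc u v : bool :=
  (depth u <= depth v)%N && (iter (depth v - depth u) par v == u).

Lemma depth_iter_par n v : depth (iter n par v) = (depth v - n)%N.
Proof.
elim: n => [|n IH] /=; first by rewrite subn0.
have [e|r] := eqVneq (iter n par v) root.
  by move: IH; rewrite e par_root depth_root; lia.
by have := depth_par r; rewrite IH; lia.
Qed.

Lemma ancP u v : reflect (exists n, u = iter n par v) (anc u v).
Proof.
apply: (iffP andP) => [[_ /eqP <-]|[n ->]]; first by eexists.
rewrite depth_iter_par; split; first by lia.
have [nv|nv] := leqP n (depth v); first by rewrite subKn.
have -> : (depth v - n = 0)%N by lia.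
rewrite subn0 -[n](subnK (ltnW nv)) iterD.
have : iter (depth v) par v = root.
  by apply/eqP; rewrite -depth_eq0 depth_iter_par subnn.
by move=> ->; elim: (n - _)%N => //= k /eqP <-; rewrite par_root.
Qed.

Lemma anc_refl v : anc v v.
Proof. by apply/ancP; exists 0%N. Qed.

Lemma anc_trans u v w : anc u v -> anc v w -> anc u w.
Proof.
by move=> /ancP[n ->] /ancP[k ->]; apply/ancP; exists (n + k)%N; rewrite iterD.
Qed.

Lemma anc_depth u v : anc u v -> (depth u <= depth v)%N.
Proof. by case/andP. Qed.

Lemma anc_eq u v : anc u v -> (depth v <= depth u)%N -> u = v.
Proof.
by case/andP => _ /eqP e d; rewrite -e (_ : _ - _ = 0)%N //; lia.
Qed.

Lemma anc_root v : anc root v.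
Proof.
apply/andP; rewrite depth_root; split => //.
by rewrite -depth_eq0 depth_iter_par subn0 subnn.
Qed.

Lemma anc_rootr u : anc u root = (u == root).
Proof.
apply/idP/eqP => [a|->]; last exact: anc_refl.
by apply: anc_eq => //; rewrite depth_root.
Qed.

Lemma anc_parE u v : v != root -> anc u v = (u == v) || anc u (par v).
Proof.
move=> vr; apply/idP/orP => [/ancP[[|n] ->]|[/eqP ->|]].
- by left.
- by right; rewrite iterSr; apply/ancP; exists n.
- exact: anc_refl.
- by move=> /ancP[n ->]; apply/ancP; exists n.+1; rewrite iterSr.
Qed.

Lemma anc_par v : anc (par v) v.
Proof. by apply/ancP; exists 1%N. Qed.

Lemma anc_comparable u v w : anc u w -> anc v w -> (depth u <= depth v)%N ->
  anc u v.
Proof.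
move=> /andP[du /eqP eu] /andP[dv /eqP ev] duv; apply/ancP.
exists (depth v - depth u)%N; rewrite -[X in _ = iter _ _ X]ev -iterD -[LHS]eu.
by congr (iter _ _ _); lia.
Qed.

Lemma anc_anti_depth u v w : anc u w -> anc v w -> depth u = depth v -> u = v.
Proof.
move=> uw vw d; apply: anc_eq; last by rewrite d.
by apply: (anc_comparable uw vw); rewrite d.
Qed.

Lemma anc_par_proper u v : anc u v -> u != v -> anc u (par v).
Proof.
have [->|vr] := eqVneq v root; first by rewrite par_root.
by rewrite anc_parE // => /orP[/eqP ->|//]; rewrite eqxx.
Qed.

Lemma not_anc_par v : v != root -> anc v (par v) = false.
Proof.
move=> vr; apply/negP => /anc_depth; have := depth_par vr; lia.
Qed.

(** * The line of non-root ancestors *)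

(** A vertex other than the root stands for the edge from its parent, so this
    list is also the path of edges from the root to [v]. *)
Fixpoint line_rec n v : seq T :=
  if n is n'.+1 then v :: line_rec n' (par v) else [::].
Definition line v := line_rec (depth v) v.

Lemma line_root : line root = [::].
Proof. by rewrite /line depth_root. Qed.

Lemma lineE v : v != root -> line v = v :: line (par v).
Proof. by move=> vr; rewrite /line {1}(depth_par vr). Qed.

Lemma par_ind (Q : T -> Prop) : Q root ->
  (forall v, v != root -> Q (par v) -> Q v) -> forall v, Q v.
Proof.
move=> Q0 QS v.
move: {2}(depth v) (erefl (depth v)) => n; elim: n v => [|n IH] v dv.
  by have /eqP -> : v == root by rewrite -depth_eq0 dv.
have vr : v != root by rewrite -depth_gt0 dv.
by apply: QS => //; apply: IH; move: (depth_par vr); lia.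
Qed.

Lemma mem_line u v : (u \in line v) = (u != root) && anc u v.
Proof.
elim/par_ind: v => [|v vr IH].
  by rewrite line_root in_nil anc_rootr andNb.
rewrite lineE // inE IH (anc_parE _ vr).
by case: (eqVneq u v) => [->|_]; rewrite ?vr.
Qed.

Lemma uniq_line v : uniq (line v).
Proof.
elim/par_ind: v => [|v vr IH]; first by rewrite line_root.
by rewrite lineE //= IH mem_line not_anc_par // andbF.
Qed.

(** A self-avoiding path from the root can only go up, since a step to the
    parent would revisit it. *)
Lemma path_up p : path adj root p -> uniq (root :: p) ->
  rev (root :: p) = rcons (line (last root p)) root.
Proof.
elim/last_ind: p => [|p y IH]; first by rewrite /= line_root.
rewrite rcons_path -rcons_cons rcons_uniq => /andP[pp ay] /andP[yn pu].
rewrite last_rcons rev_rcons (IH pp pu).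
have [[yr e]|[zr e]] := adjP ay; first by rewrite (lineE yr) -e.
move: yn; rewrite -mem_rev (IH pp pu) mem_rcons inE mem_line e anc_par andbT.
by case: eqVneq.
Qed.

Lemma path_down v : exists p, [/\ path adj root p, uniq (root :: p),
  last root p = v & rev (root :: p) = rcons (line v) root].
Proof.
suff [p [pp pu pl]] : exists p, [/\ path adj root p, uniq (root :: p) &
  last root p = v] by exists p; split => //; rewrite path_up // pl.
elim/par_ind: v => [|v vr [p [pp pu pl]]]; first by exists [::].
exists (rcons p v); rewrite rcons_path last_rcons pp pl adj_par //.
split => //; rewrite -rcons_cons rcons_uniq pu andbT -mem_rev path_up // pl.
by rewrite mem_rcons inE mem_line (negPf vr) not_anc_par.
Qed.

Lemma edge_leP g e : edges g -> edge_le g e <-> g.2 \in line e.2.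
Proof.
move=> /edgesP[gr _]; split=> [[p [pp pu pl]]|ge].
  by rewrite -mem_rev path_up // pl mem_rcons inE (negPf gr).
have [p [pp pu pl pr]] := path_down e.2; exists p; split => //.
by rewrite -mem_rev pr mem_rcons inE ge orbT.
Qed.

Lemma ray_depth (nu : nat -> T) : ray nu -> forall i, depth (nu i) = i.
Proof.
move=> [n0 na ni].
suff H i : depth (nu i) = i /\ par (nu i.+1) = nu i by move=> i; case: (H i).
elim: i => [|i [d IH]].
  rewrite n0 depth_root; split=> //; have := na 0%N; rewrite n0.
  by case/adjP => -[//]; rewrite eqxx.
have r1 : nu i.+1 != root by rewrite -n0; apply/eqP => /ni.
have di : depth (nu i.+1) = i.+1 by rewrite (depth_par r1) IH d.
split => //; case/adjP: (na i.+1) => -[r e]; first by rewrite -e.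
by move: e; rewrite IH => /ni; lia.
Qed.

Lemma ray_par (nu : nat -> T) : ray nu -> forall i, par (nu i.+1) = nu i.
Proof.
move=> nr i; have d := ray_depth nr; case: (nr) => _ na _.
apply/esym/unique_parent => //; by rewrite !d.
Qed.

Lemma ray_edge (nu : nat -> T) i : ray nu -> edge_of (nu i) (nu i.+1) = (nu i, nu i.+1).
Proof. by move=> nr; rewrite /edge_of !(ray_depth nr) leqnn. Qed.

Lemma ray_anc (nu : nat -> T) i j : ray nu -> (i <= j)%N -> anc (nu i) (nu j).
Proof.
move=> nr ij; rewrite -(subnK ij); elim: (j - i)%N => [|k IH].
  exact: anc_refl.
by rewrite addSn; apply: anc_trans IH _; rewrite -(ray_par nr); exact: anc_par.
Qed.

End TreeStructure.

Arguments par {T} y.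
Arguments anc {T} u v.

(** * Children, levels and König's lemma *)

Section LocallyFinite.
Variables (T : rootedTree) (T_lf : locally_finite_tree T).
Implicit Types (x y z u v w : T).
Local Notation root := (@troot T).

Definition neighbors x : seq T :=
  undup (projT1 (cid (proj1 (finite_seqP _) (T_lf x)))).

Lemma mem_neighbors x y : (y \in neighbors x) = adj x y.
Proof.
rewrite /neighbors; case: cid => s /= e; rewrite mem_undup.
by apply/idP/idP => [ys|xy]; [have : [set` s] y by []|have : [set y | adj x y] y by []];
  rewrite -?e // e.
Qed.

Definition children x : seq T := [seq y <- neighbors x | depth y == (depth x).+1].

Lemma uniq_neighbors x : uniq (neighbors x).
Proof. exact: undup_uniq. Qed.

Lemma uniq_children x : uniq (children x).
Proof. by rewrite filter_uniq // uniq_neighbors. Qed.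

Lemma mem_children x y : (y \in children x) = (y != root) && (par y == x).
Proof.
rewrite mem_filter mem_neighbors; apply/andP/andP => [[/eqP d a]|[yr /eqP <-]].
  by rewrite -depth_gt0 d; split => //; apply/eqP/esym/unique_parent.
by rewrite (depth_par yr) eqxx adj_par.
Qed.

Lemma child_neq_root x y : y \in children x -> y != root.
Proof. by rewrite mem_children => /andP[]. Qed.

Lemma child_par x y : y \in children x -> par y = x.
Proof. by rewrite mem_children => /andP[_ /eqP]. Qed.

Lemma child_depth x y : y \in children x -> depth y = (depth x).+1.
Proof. by move=> yx; rewrite (depth_par (child_neq_root yx)) (child_par yx). Qed.

Lemma par_notin_children x : x != root -> par x \notin children x.
Proof.
by move=> xr; apply/negP => /child_depth; have := depth_par xr; lia.
Qed.

Lemma perm_neighbors x : x != root -> perm_eq (neighbors x) (par x :: children x).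
Proof.
move=> xr; apply: uniq_perm; rewrite /= ?uniq_neighbors ?uniq_children ?par_notin_children //.
move=> y; rewrite mem_neighbors inE mem_children; apply/idP/orP.
  by case/adjP => -[yr ->]; [right; rewrite yr eqxx|left].
case=> [/eqP ->|/andP[yr /eqP <-]]; last exact: adj_par.
by rewrite adj_sym adj_par.
Qed.

Lemma perm_neighbors_root : perm_eq (neighbors root) (children root).
Proof.
apply: uniq_perm; rewrite ?uniq_neighbors ?uniq_children // => y.
rewrite mem_neighbors mem_children; apply/idP/andP => [/adjP[[yr <-]|[]]|[yr /eqP <-]].
- by rewrite yr eqxx.
- by rewrite eqxx.
- exact: adj_par.
Qed.

Lemma uniq_flatten_children (F : T -> seq T) x :
  (forall y, uniq (F y)) ->
  (forall y z v, y \in children x -> z \in children x -> v \in F y -> v \in F z -> y = z) ->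
  uniq (flatten [seq F y | y <- children x]).
Proof.
move=> uF dF.
suff H s : uniq s -> {subset s <= children x} -> uniq (flatten [seq F y | y <- s]).
  by apply: H => //; exact: uniq_children.
elim: s => [|y s IHs] //= /andP[ys us] sub.
rewrite cat_uniq uF IHs //=; last by move=> z zs; apply: sub; rewrite inE zs orbT.
rewrite andbT; apply/hasPn => v /flatten_mapP[z zs vz]; apply/negP => vy.
have zx : z \in children x by apply: sub; rewrite inE zs orbT.
have yx : y \in children x by apply: sub; rewrite inE eqxx.
by move: ys; rewrite (dF _ _ _ yx zx vy vz) zs.
Qed.

Fixpoint desc n u : seq T :=
  if n is n'.+1 then flatten [seq desc n' y | y <- children u] else [:: u].

Lemma mem_desc n u v :
  (v \in desc n u) = anc u v && (depth v == depth u + n)%N.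
Proof.
elim: n u => [|n IH] u /=.
  rewrite inE addn0; apply/eqP/andP => [->|[a /eqP d]].
    by rewrite anc_refl eqxx.
  by apply/esym/anc_eq => //; rewrite d.
apply/flatten_mapP/andP => [[y yu]|[a /eqP d]].
  rewrite IH (child_depth yu) => /andP[yv /eqP ->].
  split; last by apply/eqP; lia.
  by apply: anc_trans yv; rewrite -(child_par yu) anc_par.
exists (iter n par v).
  rewrite mem_children -depth_gt0 depth_iter_par d; apply/andP; split; first by lia.
  move: a => /andP[_ /eqP a]; rewrite -iterS -[X in _ == X]a.
  by rewrite (_ : (depth v - depth u)%N = n.+1) //; lia.
rewrite IH depth_iter_par d; apply/andP; split; last by apply/eqP; lia.
by apply/ancP; exists n.
Qed.

Lemma uniq_desc n u : uniq (desc n u).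
Proof.
elim: n u => [|n IH] u //=; apply: uniq_flatten_children => // y z v yu zu.
rewrite !mem_desc => /andP[yv _] /andP[zv _]; apply: anc_anti_depth yv zv _.
by rewrite (child_depth yu) (child_depth zu).
Qed.

Definition level n : seq T := desc n root.

Lemma mem_level n v : (v \in level n) = (depth v == n).
Proof. by rewrite mem_desc anc_root depth_root. Qed.

Lemma uniq_level n : uniq (level n).
Proof. exact: uniq_desc. Qed.

Lemma countable_tree : countable [set: T].
Proof.
have -> : [set: T] = \bigcup_(n in [set: nat]) [set` level n].
  by apply/seteqP; split => // v _; exists (depth v) => //=; rewrite mem_level.
by apply: bigcup_countable => // n _; apply: finite_set_countable; apply: finite_seq.
Qed.

Lemma level_perm_desc n k u : depth u = k ->
  perm_eq [seq v <- level (k + n) | anc u v] (desc n u).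
Proof.
move=> d; apply: uniq_perm; rewrite ?filter_uniq ?uniq_desc ?uniq_level // => v.
by rewrite mem_filter mem_level mem_desc d.
Qed.

Lemma children_root_neq0 : infinite_set [set: T] -> children root != [::].
Proof.
move=> inf; apply/eqP => c0; apply: inf.
have -> : [set: T] = [set root]; last exact: finite_set1.
apply/seteqP; split => // v _ /=; apply/eqP; apply/contraT => vr.
have : iter (depth v).-1 par v \in children root.
  rewrite mem_children -depth_gt0 depth_iter_par; move: vr; rewrite -depth_gt0 => vr.
  rewrite -iterS prednK // -depth_eq0 depth_iter_par subnn eqxx.
  by apply/andP; split => //; lia.
by rewrite c0.
Qed.

(** If lines of unbounded depth avoid [B], a vertex [u] that is an ancestor of
    the ends of such lines has a child with the same property, and following
    these children gives a ray that avoids [B]. *)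
Lemma konig (B : pred T) :
  (forall nu : nat -> T, ray nu -> exists i, B (nu i.+1)) ->
  exists N, forall v, depth v = N -> has B (line v).
Proof.
move=> hB; apply: contrapT => /forallNP noN.
pose good u := forall n, exists v,
  [/\ anc u v, depth v = (depth u + n)%N & ~~ has B (line v)].
have down u w v : anc u w -> anc w v -> ~~ has B (line v) -> ~~ has B (line w).
  move=> _ wv /hasPn nv; apply/hasPn => z; rewrite mem_line => /andP[zr zw].
  by apply: nv; rewrite mem_line zr (anc_trans zw wv).
have good0 : good root.
  move=> n; have /existsNP[v /not_implyP[dv /negP nB]] := noN n.
  by exists v; rewrite anc_root depth_root.
(* If child [y] fails at relative depth [k y], a line reaching relative depth
   [K.+1] with [K] the maximum of the [k y] passes through one of them. *)
have goodS u : good u -> exists y, y \in children u /\ good y.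
  move=> gu; apply: contrapT => /forallNP ny.
  have /choice[k kP] : forall y, exists k, y \in children u -> forall v,
      anc y v -> depth v = (depth y + k)%N -> has B (line v).
    move=> y; have [yu|yu] := boolP (y \in children u); last by exists 0%N.
    have := ny y => /not_andP[//|/existsNP[k nk]]; exists k => _ v yv dv.
    by apply: contraT => nB; case: nk; exists v.
  pose K := (\max_(y <- children u) k y)%N.
  have [v [uv dv nB]] := gu K.+1.
  pose y := iter K par v.
  have yv : anc y v by apply/ancP; exists K.
  have dy : depth y = (depth u).+1 by rewrite depth_iter_par dv; lia.
  have yu : y \in children u.
    rewrite mem_children -depth_gt0 dy /=; apply/eqP.
    have pu : anc (par y) v by apply: anc_trans yv; exact: anc_par.
    apply: anc_anti_depth pu uv _.
    by have := @depth_par _ y; rewrite -depth_gt0 dy => /(_ isT) [].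
  have kK : (k y <= K)%N by rewrite /K (big_rem y) //= leq_maxl.
  pose w := iter (K - k y) par v.
  have wv : anc w v by apply/ancP; exists (K - k y)%N.
  have dw : depth w = (depth y + k y)%N by rewrite depth_iter_par dv dy; lia.
  have yw : anc y w by apply: anc_comparable yv wv _; rewrite dw; lia.
  by have := down _ _ _ yw wv nB; rewrite (kP _ yu).
pose next (s : {u | good u}) : {u | good u} :=
  let: exist u gu := s in
  let: exist y yP := cid (goodS u gu) in exist good y (proj2 yP).
pose nu i := sval (iter i next (exist good root good0)).
have nuS i : nu i.+1 \in children (nu i).
  rewrite /nu /= /next; case: (iter _ _ _) => u gu /=.
  by case: cid => y [].
have nud i : depth (nu i) = i.
  by elim: i => [|i IH]; [rewrite /nu /= depth_root|rewrite (child_depth (nuS i)) IH].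
have nr : ray nu.
  split => // [i|i j e]; last by rewrite -(nud i) e nud.
  by have /child_par {1}<- := nuS i; apply: adj_par (child_neq_root (nuS i)).
have [i Bi] := hB nu nr.
have gi : good (nu i.+1) by exact: svalP (iter i.+1 _ _).
have [v [nv _ nB]] := gi 0%N.
move/hasPn: nB => /(_ (nu i.+1)); rewrite mem_line nv -depth_gt0 nud Bi.
by move=> /(_ isT).
Qed.

End LocallyFinite.

Lemma exists_meet (T : rootedTree) (v v' : T) :
  exists b, forall u, anc u b = anc u v && anc u v'.
Proof.
elim/par_ind: v => [|v vr [b bP]].
  by exists troot => u; rewrite anc_rootr; case: eqP => // ->; rewrite anc_root.
have [vv'|nv] := boolP (anc v v').
  exists v => u; case uv : (anc u v) => //=; by rewrite (anc_trans uv vv').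
exists b => u; rewrite bP (anc_parE _ vr).
by case: eqP => // ->; rewrite (negPf nv) andbF.
Qed.

(** * The walk on finite histories *)

Section Kernel.
Variables (R : realType) (T : rootedTree) (T_lf : locally_finite_tree T).
Variables (lambda : R) (m : T -> nat).
Hypothesis lambda_gt0 : 0 < lambda.
Hypothesis m_root : m troot = 0%N.
Hypothesis T_infinite : infinite_set [set: T].
Implicit Types (x y u v w : T) (h : seq T) (f g : seq T -> R).
Local Notation root := (@troot T).
Local Notation children := (children T_lf).
Local Notation neighbors := (neighbors T_lf).

(** A history lists the visited vertices, the most recent one first. *)
Definition pos h : T := head root h.

Definition dug h u : bool := (m u < count_mem u h)%N.

(** The parent of a visited vertex is always dug, so that the weights of the
    edges at the current vertex only depend on whether it is dug itself. *)
Definition prob h y : R :=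
  let x := pos h in
  if ~~ dug h x then (y == par x)%:R
  else if x == root then (size (children x))%:R^-1
  else (if y == par x then lambda else 1) / (lambda + (size (children x))%:R).

Definition step h f : R := \sum_(y <- neighbors (pos h)) prob h y * f (y :: h).

(** Peeling off the last step turns martingale arguments into inductions on
    time that never mention the probability space. *)
Fixpoint expect n f : R :=
  if n is n'.+1 then expect n' (step^~ f) else f [:: root].

(** The histories of positive probability. *)
Fixpoint valid h : bool :=
  match h with
  | [::] => false
  | y :: h' => if h' is x :: _ then
      valid h' && (if y \in children x then dug h' x else (x != root) && (y == par x))
    else y == root
  end.

Lemma dug_cons h y u : dug h u -> dug (y :: h) u.
Proof. by rewrite /dug /= => /leq_trans; apply; exact: leq_addl. Qed.

Lemma dug_cons_neq h y u : u != y -> dug (y :: h) u = dug h u.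
Proof. by rewrite /dug /= eq_sym => /negPf ->. Qed.

Lemma dug_mem h u : dug h u -> u \in h.
Proof. by rewrite /dug -has_pred1 has_count; exact: leq_ltn_trans. Qed.

Lemma valid_behead y h : h != [::] -> valid (y :: h) -> valid h.
Proof. by case: h => //= x h _ /andP[]. Qed.

Lemma valid_cons y h : h != [::] ->
  valid (y :: h) = valid h && (if y \in children (pos h) then dug h (pos h)
                               else (pos h != root) && (y == par (pos h))).
Proof. by case: h. Qed.

Lemma valid_neq0 h : valid h -> h != [::].
Proof. by case: h. Qed.

Lemma pos_mem h : valid h -> pos h \in h.
Proof. by case: h => //= x h _; rewrite inE eqxx. Qed.

Lemma valid_root h : valid h -> root \in h.
Proof.
elim: h => // y [|x h] IH; first by rewrite /= inE eq_sym.
by move=> vh; have /IH := @valid_behead y (x :: h) isT vh; rewrite [in X in _ -> X]inE orbC => ->.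
Qed.

Lemma dug_root h : valid h -> dug h root.
Proof. by move=> /valid_root; rewrite /dug m_root -has_count has_pred1. Qed.

(** The first visit to [u] came from its parent, which had to be dug. *)
Lemma valid_dug_par h u : valid h -> u \in h -> u != root -> dug h (par u).
Proof.
elim: h u => // y [|x h] IH u vh.
  by rewrite inE; move: vh => /= /eqP -> /eqP ->; rewrite eqxx.
have vh' := @valid_behead y (x :: h) isT vh.
rewrite inE => /orP[/eqP ->|uh ur]; last exact/dug_cons/IH.
move: vh; rewrite valid_cons // vh' /=; case: ifP => [yx dx yr|_].
  by rewrite (child_par yx); apply: dug_cons.
move=> /andP[xr /eqP e] yr; apply: dug_cons; rewrite e.
have px : par x \in x :: h.
  by apply: dug_mem; apply: IH => //; rewrite inE eqxx.
by apply: IH => //; rewrite -e.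
Qed.

Lemma valid_dug_anc h u v : valid h -> v \in h -> anc u v -> u != v -> dug h u.
Proof.
move=> vh; elim/par_ind: v => [|v vr IH] vin.
  by rewrite anc_rootr => ->.
rewrite anc_parE // => /orP[->//|uv] _.
have dp := valid_dug_par vh vin vr.
have [->//|] := eqVneq u (par v); exact/IH/uv/dug_mem.
Qed.

Lemma dug_anc h u v : valid h -> dug h v -> anc u v -> dug h u.
Proof.
move=> vh dv uv; have [->//|ne] := eqVneq u v.
exact: valid_dug_anc (dug_mem dv) uv ne.
Qed.

Lemma pos_root_dug h : valid h -> ~~ dug h (pos h) -> pos h != root.
Proof. by move=> vh; apply: contra => /eqP ->; exact: dug_root. Qed.

Lemma size_children_root : (0 < size (children root))%N.
Proof. by rewrite lt0n size_eq0 children_root_neq0. Qed.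

(** * One step of the walk *)

Lemma prob_ge0 h y : 0 <= prob h y.
Proof.
rewrite /prob; case: ifP => _; first exact: ler0n.
case: ifP => _; first by rewrite invr_ge0.
by rewrite divr_ge0 ?addr_ge0 ?(ltW lambda_gt0) //; case: ifP => _; rewrite ?ltW.
Qed.

Lemma prob_valid h y : valid h -> y \in neighbors (pos h) -> prob h y != 0 ->
  valid (y :: h).
Proof.
move=> vh; rewrite mem_neighbors valid_cons ?valid_neq0 // vh /= => xy.
rewrite /prob; have [dx|ndx] := boolP (dug h (pos h)) => /=; last first.
  have xr := pos_root_dug vh ndx.
  case: (eqVneq y (par (pos h))) => [->|]; rewrite ?eqxx // => _.
  by rewrite (negPf (par_notin_children _ xr)) xr.
move=> _; case/adjP: xy => -[r e].
  by rewrite mem_children r -e eqxx.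
by rewrite e (negPf (par_notin_children _ r)) r eqxx.
Qed.

Lemma step_undug h f : valid h -> ~~ dug h (pos h) ->
  step h f = f (par (pos h) :: h).
Proof.
move=> vh ndx; have xr := pos_root_dug vh ndx.
rewrite /step (perm_big _ (perm_neighbors T_lf xr)) big_cons /= {1}/prob ndx eqxx mul1r.
rewrite big_seq big1 ?addr0 // => y yc; rewrite /prob ndx.
suff /negPf -> : y != par (pos h) by rewrite mul0r.
by apply: contraNneq (par_notin_children T_lf xr) => <-.
Qed.

Lemma step_dug h f : dug h (pos h) -> pos h != root ->
  step h f = (lambda * f (par (pos h) :: h) + \sum_(y <- children (pos h)) f (y :: h))
             / (lambda + (size (children (pos h)))%:R).
Proof.
move=> dx xr.
rewrite /step (perm_big _ (perm_neighbors T_lf xr)) big_cons /= {1}/prob dx (negPf xr).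
rewrite eqxx mulrDl mulrAC; congr (_ + _).
rewrite mulr_suml big_seq [RHS]big_seq; apply: eq_bigr => y yc.
rewrite /prob dx (negPf xr) /= mulrC; congr (_ * _).
suff /negPf -> : y != par (pos h) by rewrite mul1r.
by apply: contraNneq (par_notin_children T_lf xr) => <-.
Qed.

Lemma step_root h f : valid h -> pos h = root ->
  step h f = (\sum_(y <- children root) f (y :: h)) / (size (children root))%:R.
Proof.
move=> vh xr; rewrite /step xr (perm_big _ (perm_neighbors_root T_lf)) /=.
rewrite mulr_suml; apply: eq_bigr => y yc.
by rewrite /prob xr dug_root //= eqxx mulrC.
Qed.

Lemma den_gt0 x : 0 < lambda + (size (children x))%:R.
Proof. by rewrite ltr_wpDr. Qed.

Lemma step_cst h c : valid h -> step h (fun=> c) = c.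
Proof.
move=> vh; have [dx|ndx] := boolP (dug h (pos h)); last by rewrite step_undug.
have [xr|xr] := eqVneq (pos h) root; last first.
  rewrite step_dug // big_const_seq count_predT iter_addr_0.
  rewrite -[c *+ _]mulr_natl -mulrDl mulrAC divff ?mul1r //.
  by rewrite gt_eqF // den_gt0.
rewrite step_root // big_const_seq count_predT iter_addr_0 -[c *+ _]mulr_natl mulrAC divff ?mul1r //.
by rewrite pnatr_eq0 -lt0n size_children_root.
Qed.

Lemma step_le h f g : valid h -> (forall y, valid (y :: h) -> f (y :: h) <= g (y :: h)) ->
  step h f <= step h g.
Proof.
move=> vh fg; rewrite /step big_seq [leRHS]big_seq; apply: ler_sum => y yx.
have [->|p0] := eqVneq (prob h y) 0; first by rewrite !mul0r.
by rewrite ler_wpM2l ?prob_ge0 // fg // prob_valid.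
Qed.

Lemma step_eq h f g : valid h -> (forall y, valid (y :: h) -> f (y :: h) = g (y :: h)) ->
  step h f = step h g.
Proof.
by move=> vh fg; apply/eqP; rewrite eq_le !step_le // => y vy; rewrite fg.
Qed.

Lemma stepZ h c f : step h (fun h' => c * f h') = c * step h f.
Proof. by rewrite /step mulr_sumr; apply: eq_bigr => y _; rewrite mulrCA. Qed.

Lemma stepD h f g : step h (fun h' => f h' + g h') = step h f + step h g.
Proof. by rewrite /step -big_split; apply: eq_bigr => y _; rewrite mulrDr. Qed.

(** * Expectation over histories of a given length *)

Lemma expect_le n f g :
  (forall h, valid h -> size h = n.+1 -> f h <= g h) -> expect n f <= expect n g.
Proof.
elim: n f g => [|n IH] f g fg /=; first by apply: fg => //=; rewrite eqxx.
by apply: IH => h vh sh; apply: step_le => // y vy; apply: fg => //=; rewrite sh.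
Qed.

Lemma expect_eq n f g :
  (forall h, valid h -> size h = n.+1 -> f h = g h) -> expect n f = expect n g.
Proof. by move=> fg; apply/eqP; rewrite eq_le !expect_le // => h vh sh; rewrite fg. Qed.

Lemma expectZ n c f : expect n (fun h => c * f h) = c * expect n f.
Proof.
elim: n f => [//|n IH] f /=; rewrite -IH; apply: expect_eq => h _ _.
exact: stepZ.
Qed.

Lemma expectD n f g :
  expect n (fun h => f h + g h) = expect n f + expect n g.
Proof.
elim: n f g => [//|n IH] f g /=; rewrite -IH; apply: expect_eq => h _ _.
exact: stepD.
Qed.

Lemma expect_cst n c : expect n (fun=> c) = c.
Proof.
elim: n => //= n IH; rewrite -[RHS]IH; apply: expect_eq => h vh _.
exact: step_cst.
Qed.

Lemma expect_sum n (I : Type) (r : seq I) (F : I -> seq T -> R) :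
  expect n (fun h => \sum_(i <- r) F i h) = \sum_(i <- r) expect n (F i).
Proof.
elim: r => [|i r IH].
  rewrite big_nil -[RHS](expect_cst n); apply: expect_eq => h _ _.
  by rewrite big_nil.
rewrite big_cons -IH -expectD; apply: expect_eq => h _ _.
by rewrite big_cons.
Qed.

Lemma expect_ge0 n f : (forall h, valid h -> 0 <= f h) -> 0 <= expect n f.
Proof. by move=> f0; rewrite -(expect_cst n 0); apply: expect_le => h vh _; apply: f0. Qed.

Lemma expect_supermart n f :
  (forall h, valid h -> step h f <= f h) -> expect n f <= f [:: root].
Proof.
move=> sf; elim: n => //= n; apply: le_trans; apply: expect_le => h vh _.
exact: sf.
Qed.

Lemma expect_submart n f :
  (forall h, valid h -> f h <= step h f) -> f [:: root] <= expect n f.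
Proof.
move=> sf; elim: n => //= n /le_trans; apply; apply: expect_le => h vh _.
exact: sf.
Qed.

(** * Histories stopped at the return to the root *)

Definition some_dug h : bool := has (fun u => (u != root) && dug h u) h.

(** The extracted walk is back at the root as soon as the walk visits the root
    after having dug another vertex. *)
Fixpoint returned h : bool :=
  if h is y :: h' then returned h' || ((y == root) && some_dug h') else false.

Fixpoint stopped h : seq T :=
  if h is y :: h' then (if returned h' then stopped h' else h) else [::].

Lemma some_dugP h : reflect (exists2 u, u != root & dug h u) (some_dug h).
Proof.
apply: (iffP hasP) => [[u _ /andP[]]|[u ur du]]; first by exists u.
by exists u; rewrite ?ur ?dug_mem.
Qed.

Lemma some_dug_cons y h : some_dug h -> some_dug (y :: h).
Proof.
by move=> /some_dugP[u ur du]; apply/some_dugP; exists u => //; apply: dug_cons.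
Qed.

Lemma stopped_id h : ~~ returned h -> stopped h = h.
Proof. by case: h => //= y h; rewrite negb_or => /andP[/negPf ->]. Qed.

Lemma stopped_valid h : valid h -> valid (stopped h).
Proof.
elim: h => // y h IH vh; rewrite /=; case: ifP => // rh.
by apply/IH/(valid_behead _ vh); case: (h) rh.
Qed.

Lemma returned_stopped h : returned h ->
  pos (stopped h) = root /\ some_dug (stopped h).
Proof.
elim: h => // y h IH /=; case: ifP => [rh _|_ /= /andP[/eqP -> sd]].
  exact: IH.
by split => //; apply: some_dug_cons.
Qed.

(** Were [u] dug, the current visit to the root would be the return. *)
Lemma root_undug h u : valid h -> ~~ returned h -> pos h = root -> u != root ->
  ~~ dug h u.
Proof.
case: h => // y h vh /= + yr ur; rewrite yr eqxx negb_or /= => /andP[_].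
apply: contra; rewrite dug_cons_neq // => du; apply/some_dugP; by exists u.
Qed.

(** Optional stopping: only the steps before the return matter. *)
Lemma step_stopped h f : valid h ->
  (~~ returned h -> step h f <= f h) ->
  step h (fun h' => f (stopped h')) <= f (stopped h).
Proof.
move=> vh sf; have [rh|nrh] := boolP (returned h).
  have -> : step h (fun h' => f (stopped h')) = step h (fun=> f (stopped h)).
    by apply: step_eq => // y _; rewrite /= rh.
  by rewrite step_cst.
have -> : step h (fun h' => f (stopped h')) = step h f.
  by apply: step_eq => // y _; rewrite /= (negPf nrh).
by rewrite stopped_id // sf.
Qed.

Lemma step_stopped_ge h f : valid h ->
  (~~ returned h -> f h <= step h f) ->
  f (stopped h) <= step h (fun h' => f (stopped h')).
Proof.
move=> vh sf; have := @step_stopped h (fun h => - f h) vh.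
have N g : step h (fun h' => - g h') = - step h g.
  by rewrite -mulN1r -stepZ; apply: step_eq => // y _; rewrite mulN1r.
by rewrite !N !lerN2; apply.
Qed.

End Kernel.

(** * Potentials *)

Section Potential.
Variables (R : realType) (T : rootedTree) (T_lf : locally_finite_tree T).
Variables (lambda : R) (m : T -> nat).
Hypothesis lambda_gt0 : 0 < lambda.
Hypothesis m_root : m troot = 0%N.
Hypothesis T_infinite : infinite_set [set: T].
Implicit Types (x y u v w : T) (h : seq T) (A : pred T) (S : seq T) (s : T -> R).
Local Notation root := (@troot T).
Local Notation children := (children T_lf).
Local Notation dug := (dug m).
Local Notation valid := (valid T_lf m).
Local Notation step := (step T_lf lambda m).
Local Notation returned := (returned m).

(** How many times the walk on a line through [u] still has to reach [u] before
    the root: once per missing visit, or once if [u] is dug but the walk is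
    outside of the subtree at [u]. An excursion reaches depth one for free. *)
Definition debt h u : nat :=
  if dug h u then nat_of_bool (~~ anc u (pos h))
  else if depth u == 1%N then 0%N else ((m u).+1 - count_mem u h)%N.

Definition debt0 u : nat := if depth u == 1%N then 0%N else (m u).+1.

(** If [s u] is the probability to reach [u] once, this is the probability to
    clear the debts of the vertices of [S]; the predicate [A] discards those
    that have ceased to matter. *)
Definition potential S A s h : R := \prod_(u <- S | A u) s u ^+ debt h u.

Definition factor S A s u : R := if (u \in S) && A u then s u else 1.

Lemma debt_start u : u != root -> debt [:: root] u = debt0 u.
Proof. by rewrite /debt /debt0 /dug /= eq_sym => /negPf ->; rewrite subn0. Qed.

(** One step of the walk changes the debt of at most one vertex. *)
Lemma potential_update S A s x h h' : uniq S ->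
  (forall u, u != x -> debt h' u = debt h u) ->
  forall c, (x \in S -> A x -> s x ^+ debt h' x = s x ^+ debt h x * c) ->
  potential S A s h' = potential S A s h * (if (x \in S) && A x then c else 1).
Proof.
move=> uS eqd c hc; rewrite /potential.
have [/andP[xS Ax]|nx] := boolP ((x \in S) && A x).
  rewrite !(big_mkcond A) (bigD1_seq x) // [in RHS](bigD1_seq x) //= Ax hc //.
  rewrite mulrAC; congr (_ * _ * _); apply: eq_bigr => u ux.
  by case: ifP => // _; rewrite eqd.
rewrite mulr1 big_seq_cond [RHS]big_seq_cond; apply: eq_bigr => u uSA.
by rewrite eqd //; apply: contraNneq nx => <-.
Qed.

Lemma debt_child h y u : y \in children (pos h) -> u != y -> debt (y :: h) u = debt h u.
Proof.
move=> yc uy; rewrite /debt dug_cons_neq //= (eq_sym y) (negPf uy) add0n.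
by rewrite anc_parE ?(child_neq_root yc) // (negPf uy) /= (child_par yc).
Qed.

Lemma debt_child_self h y : y \in children (pos h) -> pos h != root ->
  debt h y = (debt (y :: h) y).+1.
Proof.
clear lambda_gt0 m_root T_infinite lambda => yc xr.
have d1 : depth y != 1%N by rewrite (child_depth yc) eqSS depth_eq0.
have nyx : anc y (pos h) = false.
  by rewrite -(child_par yc) not_anc_par // (child_neq_root yc).
rewrite /debt nyx (negPf d1) /= anc_refl /= /dug /= eqxx.
by case: ltnP => a; case: ltnP => b /=; lia.
Qed.

Lemma debt_child_root h y : y \in children (pos h) -> pos h = root -> ~~ dug h y ->
  debt (y :: h) y = debt h y.
Proof.
move=> yc xr ndy; rewrite /debt (negPf ndy) (child_depth yc) xr depth_root eqxx.
by rewrite /= anc_refl; case: ifP.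
Qed.

(** A visit to a child clears one unit of its debt, whether it is already dug or
    still being dug. At depth one no debt is counted, and before the return a
    child of the root cannot be visited after it has been dug and left. *)
Lemma potential_child S A s h y : uniq S -> valid h -> ~~ returned h ->
  y \in children (pos h) ->
  (forall u, u \in S -> A u -> (1 < depth u)%N -> 0 < s u) ->
  potential S A s (y :: h) =
    potential S A s h *
    (if (y \in S) && A y && (pos h != root) then (s y)^-1 else 1).
Proof.
move=> uS vh nrh yc s0.
have [xr|xr] := eqVneq (pos h) root.
  rewrite andbF (@potential_update _ _ _ y h _ uS _ 1).
  - by rewrite if_same.
  - by move=> u; apply: debt_child.
  - move=> _ _; rewrite mulr1 debt_child_root //.
    exact: (root_undug vh nrh xr (child_neq_root yc)).
rewrite andbT; apply: (potential_update uS) => [u|yS Ay]; first exact: debt_child.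
rewrite (debt_child_self yc xr) exprSr mulfK // gt_eqF // s0 //.
by rewrite (child_depth yc) ltnS depth_gt0.
Qed.

Lemma debt_par h u : valid h -> pos h != root -> u != pos h ->
  debt (par (pos h) :: h) u = debt h u.
Proof.
move=> vh xr ux; set x := pos h in ux *.
have dp : dug h (par x) := valid_dug_par vh (pos_mem vh) xr.
have [->|up] := eqVneq u (par x).
  by rewrite /debt dug_cons //= dp anc_refl anc_par.
rewrite /debt dug_cons_neq //= (eq_sym (par x)) (negPf up) add0n.
by rewrite (anc_parE _ xr) (negPf ux).
Qed.

(** Leaving a dug vertex towards the root puts it back into debt. *)
Lemma potential_par S A s h : uniq S -> valid h -> pos h != root ->
  dug h (pos h) -> potential S A s (par (pos h) :: h) =
    potential S A s h * factor S A s (pos h).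
Proof.
move=> uS vh xr dx; rewrite /factor.
apply: (potential_update uS) => [u ux|xS Ax]; first exact: debt_par.
by rewrite /debt dug_cons //= dx anc_refl not_anc_par // expr0 expr1 mul1r.
Qed.

(** The forced step back from an undug vertex changes no debt. *)
Lemma potential_undug S A s h : uniq S -> valid h -> ~~ dug h (pos h) ->
  potential S A s (par (pos h) :: h) = potential S A s h.
Proof.
move=> uS vh ndx; have xr := pos_root_dug m_root vh ndx.
rewrite (@potential_update _ _ _ (pos h) h _ uS _ 1).
- by rewrite if_same mulr1.
- by move=> u ux; apply: debt_par.
move=> _ _; have xp : pos h != par (pos h) by rewrite eq_sym par_neq.
by rewrite mulr1 /debt dug_cons_neq //= (negPf ndx) (negPf (par_neq xr)).
Qed.

Lemma potential_ge0 S A s h : (forall u, 0 <= s u) -> 0 <= potential S A s h.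
Proof. by move=> s0; apply: prodr_ge0 => u _; rewrite exprn_ge0. Qed.

Lemma potential_le1 S A s h : (forall u, 0 <= s u <= 1) -> potential S A s h <= 1.
Proof.
move=> s0; suff /andP[] : 0 <= potential S A s h <= 1 by [].
apply: (big_ind (fun a : R => 0 <= a <= 1)) => [|a b|u _].
- by rewrite ler01 lexx.
- by move=> /andP[a0 a1] /andP[b0 b1]; rewrite mulr_ge0 // mulr_ile1.
by have /andP[u0 u1] := s0 u; rewrite exprn_ge0 // exprn_ile1.
Qed.

(** The conductance towards the parent is [lambda] times the one towards a
    child, whence the drift of the potential at a dug vertex. *)
Lemma step_potential S A s h : uniq S -> valid h -> ~~ returned h ->
  (forall u, u \in S -> A u -> (1 < depth u)%N -> 0 < s u) ->
  dug h (pos h) -> pos h != root ->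
  step h (potential S A s) = potential S A s h *
   (1 + (lambda * (factor S A s (pos h) - 1) +
         \sum_(y <- children (pos h)) ((factor S A s y)^-1 - 1))
        / (lambda + (size (children (pos h)))%:R)).
Proof.
move=> uS vh nrh s0 dx xr; rewrite step_dug // potential_par //.
have -> : \sum_(y <- children (pos h)) potential S A s (y :: h) =
    potential S A s h * (\sum_(y <- children (pos h)) ((factor S A s y)^-1 - 1) +
                         (size (children (pos h)))%:R).
  have -> : (size (children (pos h)))%:R = \sum_(y <- children (pos h)) (1 : R).
    by rewrite big_const_seq count_predT iter_addr_0.
  rewrite -big_split mulr_sumr big_seq [RHS]big_seq; apply: eq_bigr => y yc /=.
  rewrite potential_child // subrK xr andbT /factor.
  by case: ifP => _; rewrite ?invr1.
have dn : lambda + (size (children (pos h)))%:R != 0 by rewrite gt_eqF // den_gt0.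
by field.
Qed.

End Potential.

Lemma sum_le_unique (R : realType) (I : eqType) (r : seq I) (Q : pred I)
    (c : I -> R) (C : R) : uniq r -> 0 <= C ->
  (forall y z, y \in r -> z \in r -> Q y -> Q z -> y = z) ->
  (forall y, y \in r -> Q y -> c y <= C) ->
  \sum_(y <- r | Q y) c y <= C.
Proof.
move=> ur C0 uQ cC; have [/hasP[z zr Qz]|/hasPn nQ] := boolP (has Q r).
  rewrite big_mkcond (bigD1_seq z) //= Qz big_seq_cond big1 ?addr0 ?cC // => y.
  case/andP => yr yz; case: ifP => // Qy.
  by move: yz; rewrite (uQ y z) // eqxx.
by rewrite big_seq_cond big1 // => y /andP[/nQ/negPf ->].
Qed.

(** * Digging several vertices before the return *)

Section Digging.
Variables (R : realType) (T : rootedTree) (T_lf : locally_finite_tree T).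
Variables (lambda : R) (m : T -> nat).
Hypothesis lambda_gt0 : 0 < lambda.
Hypothesis m_root : m troot = 0%N.
Hypothesis T_infinite : infinite_set [set: T].
Implicit Types (x y u v w : T) (h : seq T) (A : pred T) (S W : seq T) (s : T -> R).
Local Notation root := (@troot T).
Local Notation children := (children T_lf).
Local Notation dug := (dug m).
Local Notation valid := (valid T_lf m).
Local Notation step := (step T_lf lambda m).
Local Notation expect := (expect T_lf lambda m).
Local Notation returned := (returned m).
Local Notation stopped := (stopped m).
Local Notation debt := (debt m).
Local Notation debt0 := (debt0 m).
Local Notation potential := (potential m).

Definition lines W : seq T := undup (flatten [seq line w | w <- W]).

(** A line is dropped once its tip is dug: its debts would otherwise come back
    when the walk leaves the tip, and the potential would not stay at one. *)
Definition active W h u : bool := has (fun w => anc u w && ~~ dug h w) W.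

Lemma mem_lines W u : (u \in lines W) = (u != root) && has (anc u) W.
Proof.
rewrite mem_undup; apply/flatten_mapP/andP => [[w wW]|[ur /hasP[w wW uw]]].
  by rewrite mem_line => /andP[-> uw]; split => //; apply/hasP; exists w.
by exists w => //; rewrite mem_line ur.
Qed.

(** When a tip gets dug the walk stands on it, so that no vertex of its line is
    in debt, and dropping the line leaves the potential unchanged. *)
Lemma potential_active W s y h : valid (y :: h) ->
  potential (lines W) (active W h) s (y :: h) =
  potential (lines W) (active W (y :: h)) s (y :: h).
Proof.
move=> vyh; rewrite /potential big_mkcond [RHS]big_mkcond; apply: eq_bigr => u _.
have [/hasP[w wW /andP[uw ndw]]|nact] := boolP (active W (y :: h) u).
  case: ifP => // /negP; case; apply/hasP; exists w; rewrite // uw.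
  by apply: contra ndw; apply: dug_cons.
case: ifP => // /hasP[w wW /andP[uw ndw]].
have dw : dug (y :: h) w.
  by apply: contraR nact => nd; apply/hasP; exists w; rewrite ?uw.
have wy : w = y.
  by apply/eqP; apply: contraLR dw => wy; rewrite dug_cons_neq.
rewrite wy in uw dw.
by rewrite /debt (dug_anc vyh dw uw) /= uw expr0.
Qed.

Lemma step_root_potential S A s h : uniq S -> valid h -> ~~ returned h ->
  (forall u, u \in S -> A u -> (1 < depth u)%N -> 0 < s u) ->
  pos h = root -> step h (potential S A s) = potential S A s h.
Proof.
move=> uS vh nrh s0 xr.
rewrite -[RHS](step_cst lambda_gt0 m_root T_infinite _ vh).
apply: (step_eq lambda_gt0 m_root vh) => y.
rewrite (valid_cons _ _ _ (valid_neq0 vh)) => /andP[_].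
case: ifP => [yc _|_]; last by rewrite xr eqxx.
by rewrite (potential_child uS vh nrh yc) // xr eqxx andbF mulr1.
Qed.

(** The condition on [s] makes the potential of the active lines a
    supermartingale, and it is one when all of [W] is dug. *)
Lemma expect_all_dug_le W s n :
  (forall u, 0 <= s u <= 1) ->
  (forall u, u \in lines W -> (1 < depth u)%N -> 0 < s u) ->
  (forall x, x \in lines W ->
     \sum_(y <- children x | y \in lines W) ((s y)^-1 - 1) <= lambda * (1 - s x)) ->
  root \notin W ->
  expect n (fun h => (all (dug (stopped h)) W)%:R) <=
    \prod_(u <- lines W) s u ^+ debt0 u.
Proof.
move=> s01 spos hs rW; set S := lines W.
have uS : uniq S by exact: undup_uniq.
pose F h := potential S (active W h) s h.
have F0 h : 0 <= F h by apply: potential_ge0 => u; case/andP: (s01 u).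
have <- : F [:: root] = \prod_(u <- S) s u ^+ debt0 u.
  rewrite /F /potential big_seq_cond [RHS]big_seq; apply: eq_big => u.
    apply: andb_idr; rewrite mem_lines => /andP[ur /hasP[w wW uw]].
    apply/hasP; exists w => //; rewrite uw /dug /= eq_sym.
    by have /negPf -> : w != root by apply: contraNneq rW => <-.
  by move=> /andP[+ _]; rewrite mem_lines => /andP[ur _]; rewrite debt_start.
pose Fs h := F (stopped h).
have -> : F [:: root] = Fs [:: root] by [].
apply: (@le_trans _ _ (expect n Fs)).
  apply: (expect_le lambda_gt0 m_root) => h vh _; rewrite /Fs.
  case: (boolP (all _ _)) => [/allP ad|_]; last exact: F0.
  rewrite /F /potential big_pred0 // => u; apply/negP => /hasP[w wW].
  by rewrite ad // andbF.
apply: (expect_supermart lambda_gt0 m_root) => h vh.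
apply: (step_stopped lambda_gt0 m_root T_infinite vh) => nrh.
pose A := active W h.
have -> : step h F = step h (potential S A s).
  by apply: (step_eq lambda_gt0 m_root vh) => y vy; rewrite /F -potential_active.
have sposA u : u \in S -> A u -> (1 < depth u)%N -> 0 < s u.
  by move=> uS1 _; apply: spos.
have [dx|ndx] := boolP (dug h (pos h)); last first.
  by rewrite (step_undug lambda m_root _ vh ndx) (potential_undug m_root _ _ uS vh ndx).
have [xr|xr] := eqVneq (pos h) root.
  by rewrite step_root_potential.
rewrite (step_potential lambda_gt0 uS vh nrh sposA dx xr).
rewrite -[leRHS]mulr1 ler_wpM2l ?F0 // gerDl.
rewrite pmulr_lle0 ?invr_gt0 ?den_gt0 //.
have AS y : y \in children (pos h) -> (y \in S) && A y -> (pos h \in S) && A (pos h).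
  move=> yc /andP[]; rewrite !mem_lines xr /= => /andP[yr /hasP[w wW yw]] /hasP[w' wW' /andP[yw' nd]].
  have xy : anc (pos h) y by rewrite -(child_par yc) anc_par.
  apply/andP; split; apply/hasP; first by exists w => //; exact: anc_trans yw.
  by exists w'; rewrite // nd andbT; apply: anc_trans yw'.
rewrite {1}/factor; case: ifP => [/andP[xS Ax]|nA].
  have : \sum_(y <- children (pos h)) ((factor S A s y)^-1 - 1) <=
      \sum_(y <- children (pos h) | y \in S) ((s y)^-1 - 1).
    rewrite [leRHS]big_mkcond big_seq [leRHS]big_seq; apply: ler_sum => y yc.
    rewrite /factor; case: ifP => [/andP[-> _]//|_]; rewrite invr1 subrr.
    case: ifP => // yS; have y1 : (1 < depth y)%N.
      by rewrite (child_depth yc) ltnS depth_gt0.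
    by rewrite subr_ge0 invf_ge1 ?spos //; case/andP: (s01 y).
  have := hs _ xS; lra.
rewrite subrr mulr0 add0r big_seq big1 // => y yc.
rewrite /factor; case: ifP => [/(AS y yc)|_]; first by rewrite nA.
by rewrite invr1 subrr.
Qed.

(** * Resistances *)

(** The resistance between the root and depth [d] on a line whose edge between
    depths [i] and [i + 1] has conductance [lambda ^- i]. *)
Definition resistance d : R := \sum_(i < d) lambda ^+ i.

(** The probability that the biased walk on a line, started at the parent of
    [u], hits [u] before the root. *)
Definition ratio u : R := resistance (depth u).-1 / resistance (depth u).

(** The probability that the walk confined to the line of [v] digs [v] before
    it returns to the root. *)
Definition Psi v : R := \prod_(u <- line v) ratio u ^+ debt0 u.

Lemma resistance0 : resistance 0 = 0.
Proof. by rewrite /resistance big_ord0. Qed.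

Lemma resistanceS d : resistance d.+1 = resistance d + lambda ^+ d.
Proof. by rewrite /resistance big_ord_recr. Qed.

Lemma resistance_ge0 d : 0 <= resistance d.
Proof. by apply: sumr_ge0 => i _; rewrite exprn_ge0 // ltW. Qed.

Lemma resistance_gt0 d : (0 < d)%N -> 0 < resistance d.
Proof. by case: d => // d _; rewrite resistanceS ltr_wpDl ?resistance_ge0 // exprn_gt0. Qed.

Lemma ratio_le1 u : 0 <= ratio u <= 1.
Proof.
rewrite /ratio divr_ge0 ?resistance_ge0 //=.
case: (depth u) => [|d]; first by rewrite resistance0 mul0r ler01.
by rewrite ler_pdivrMr ?resistance_gt0 // mul1r resistanceS lerDl exprn_ge0 // ltW.
Qed.

Lemma ratio_gt0 u : (1 < depth u)%N -> 0 < ratio u.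
Proof. by move=> u1; rewrite /ratio divr_gt0 ?resistance_gt0 //; case: (depth u) u1 => [|[|]]. Qed.

(** The resistance is harmonic along a line: what the child brings is what the
    parent takes. *)
Lemma ratio_child x y : x != root -> y \in children x ->
  (ratio y)^-1 - 1 = lambda * (1 - ratio x).
Proof.
move=> xr yc; rewrite /ratio (child_depth yc) /=.
have := xr; rewrite -depth_gt0; case: (depth x) => // d _ /=.
rewrite invf_div [resistance d.+2]resistanceS.
have rd : resistance d.+1 != 0 by rewrite gt_eqF // resistance_gt0.
have -> : resistance d = resistance d.+1 - lambda ^+ d by rewrite resistanceS addrK.
by rewrite exprS; field.
Qed.

Lemma Psi_par v : v != root -> Psi v = ratio v ^+ debt0 v * Psi (par v).
Proof. by move=> vr; rewrite /Psi (lineE vr) big_cons. Qed.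

Lemma debt0_gt1 u : (1 < depth u)%N -> debt0 u = (m u).+1.
Proof. by rewrite /debt0; case: (depth u) => [|[|]]. Qed.

Lemma Psi_gt0 v : 0 < Psi v.
Proof.
rewrite /Psi big_seq_cond; apply: prodr_gt0 => u.
rewrite andbT mem_line -depth_gt0 => /andP[u0 _].
have [u1|u1] := ltnP 1 (depth u); first by rewrite exprn_gt0 // ratio_gt0.
by rewrite /debt0 (_ : depth u == 1%N) // eqn_leq u0 u1.
Qed.

End Digging.

(** * Quasi-independence of two vertices *)

Section PairBound.
Variables (R : realType) (T : rootedTree) (T_lf : locally_finite_tree T).
Variables (lambda : R) (m : T -> nat).
Hypothesis lambda_gt0 : 0 < lambda.
Hypothesis m_root : m troot = 0%N.
Hypothesis T_infinite : infinite_set [set: T].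
Implicit Types (x y u v w b : T) (h : seq T).
Local Notation root := (@troot T).
Local Notation children := (children T_lf).
Local Notation dug := (dug m).
Local Notation expect := (expect T_lf lambda m).
Local Notation stopped := (stopped m).
Local Notation debt0 := (debt0 m).
Local Notation resistance := (resistance lambda).
Local Notation ratio := (ratio lambda).
Local Notation Psi := (Psi lambda m).

(** On the arms above the separation vertex [b], the stem from the root to [b]
    counts twice. At [b] each arm then brings half of what the stem takes, so
    that the two arms together are balanced. *)
Definition fork b u : R :=
  if anc u b then ratio u
  else (resistance (depth b) + resistance (depth u).-1) /
       (resistance (depth b) + resistance (depth u)).

Lemma fork_den b u : u != root -> 0 < resistance (depth b) + resistance (depth u).
Proof.
by rewrite -depth_gt0 => u0; rewrite ltr_wpDl ?resistance_ge0 // resistance_gt0.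
Qed.

Lemma fork_le1 b u : 0 <= fork b u <= 1.
Proof.
rewrite /fork; case: ifP => [_|nub]; first exact: ratio_le1.
have ur : u != root by apply: contraFneq nub => ->; exact: anc_root.
rewrite divr_ge0 ?addr_ge0 ?resistance_ge0 //= ler_pdivrMr ?fork_den // mul1r lerD2l.
move: ur; rewrite -depth_gt0; case: (depth u) => // d _ /=.
by rewrite resistanceS lerDl exprn_ge0 // ltW.
Qed.

Lemma fork_gt0 b u : (1 < depth u)%N -> 0 < fork b u.
Proof.
move=> u1; rewrite /fork; case: ifP => _; first exact: (ratio_gt0 lambda_gt0 u1).
have u0 : (0 < (depth u).-1)%N by case: (depth u) u1 => [|[|]].
by rewrite divr_gt0 ?ltr_wpDl ?resistance_ge0 ?resistance_gt0 // (ltn_trans _ u1).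
Qed.

Lemma fork_child_off b x y : y \in children x -> ~~ anc x b ->
  (fork b y)^-1 - 1 = lambda * (1 - fork b x).
Proof.
move=> yc nxb; have nyb : ~~ anc y b.
  by apply: contra nxb; apply: anc_trans; rewrite -(child_par yc) anc_par.
have xr : x != root by apply: contraNneq nxb => ->; exact: anc_root.
rewrite /fork (negPf nxb) (negPf nyb) (child_depth yc) /=.
have := fork_den b xr; have := xr; rewrite -depth_gt0.
case: (depth x) => // d _ /= D0; have D1 := lt0r_neq0 D0.
rewrite invf_div [resistance d.+2]resistanceS.
have -> : resistance d = resistance d.+1 - lambda ^+ d.
  by rewrite resistanceS addrK.
by rewrite exprS; field.
Qed.

Lemma fork_child_at b y : y \in children b -> b != root ->
  (fork b y)^-1 - 1 = lambda * (1 - fork b b) / 2.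
Proof.
move=> yc br; have nyb : ~~ anc y b by rewrite -(child_par yc) not_anc_par // (child_neq_root yc).
rewrite /fork (negPf nyb) anc_refl -(ratio_child lambda_gt0 br yc) /ratio (child_depth yc) /=.
have r0 : resistance (depth b) != 0 by rewrite gt_eqF // resistance_gt0 // depth_gt0.
by rewrite !invf_div [resistance _.+1]resistanceS; field; rewrite r0 -mulr2n mulrn_eq0.
Qed.

(** On the stem and on the arms the balance is that of a single line, and at [b]
    the two arms share the drift of the stem. *)
Lemma fork_super b v v' : (forall u, anc u b = anc u v && anc u v') ->
  forall x, x \in lines [:: v; v'] ->
     \sum_(y <- children x | y \in lines [:: v; v']) ((fork b y)^-1 - 1) <=
     lambda * (1 - fork b x).
Proof.
move=> bP x; rewrite mem_lines => /andP[xr xS].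
have bv : anc b v by move: (anc_refl b); rewrite bP => /andP[].
have bv' : anc b v' by move: (anc_refl b); rewrite bP => /andP[].
have C0 : 0 <= lambda * (1 - fork b x).
  by rewrite mulr_ge0 ?(ltW lambda_gt0) // subr_ge0; case/andP: (fork_le1 b x).
have inS y : y \in children x -> (y \in lines [:: v; v']) = anc y v || anc y v'.
  by move=> yc; rewrite mem_lines /= orbF (child_neq_root yc).
have sameline w y z : y \in children x -> z \in children x -> anc y w -> anc z w -> y = z.
  by move=> yc zc yw zw; apply: anc_anti_depth yw zw _; rewrite (child_depth yc) (child_depth zc).
have xy y : y \in children x -> anc x y by move=> yc; rewrite -(child_par yc) anc_par.
have [xb|nxb] := boolP (anc x b); last first.
  apply: sum_le_unique => //; first exact: uniq_children.
    move=> y z yc zc; rewrite !inS //.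
    move: nxb; rewrite bP negb_and => nx.
    have no w : ~~ anc x w -> forall y, y \in children x -> anc y w = false.
      by move=> nxw y' yc'; apply: contraNF nxw; apply: anc_trans; exact: xy.
    by case/orP: nx => /no nx; rewrite !nx ?orbF //=; apply: sameline.
  by move=> y yc _; rewrite (fork_child_off yc nxb).
have [xeb|xb'] := eqVneq x b.
  subst b; have half w : anc x w -> 
      \sum_(y <- children x | anc y w) ((fork x y)^-1 - 1) <= lambda * (1 - fork x x) / 2.
    move=> xw; apply: sum_le_unique; rewrite ?uniq_children ?divr_ge0 //.
      by move=> y z yc zc; apply: sameline.
    by move=> y yc _; rewrite (fork_child_at yc xr).
  have -> : lambda * (1 - fork x x) = lambda * (1 - fork x x) / 2 + lambda * (1 - fork x x) / 2.
    by field.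
  apply: le_trans (lerD (half _ bv) (half _ bv')).
  rewrite [leRHS](_ : _ = \sum_(y <- children x) ((if anc y v then (fork x y)^-1 - 1 else 0)
     + (if anc y v' then (fork x y)^-1 - 1 else 0))); last first.
    by rewrite big_mkcond [X in _ + X]big_mkcond -big_split.
  rewrite big_mkcond big_seq [leRHS]big_seq; apply: ler_sum => y yc.
  have p0 : 0 <= (fork x y)^-1 - 1 by rewrite (fork_child_at yc xr) divr_ge0.
  by rewrite inS //; case: (anc y v); case: (anc y v'); rewrite /= ?addr0 ?add0r ?lerDl.
have [z [zc zb]] : exists z, z \in children x /\ anc z b.
  have dxb : (depth x < depth b)%N.
    by rewrite ltnNge; apply: contra xb' => d; apply/eqP/anc_eq.
  pose z := iter (depth b - (depth x).+1) par b.
  have zb : anc z b by apply/ancP; eexists.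
  have dz : depth z = (depth x).+1 by rewrite depth_iter_par; lia.
  have zr : z != root by rewrite -depth_gt0 dz.
  exists z; split => //; rewrite mem_children zr /=; apply/eqP.
  apply: anc_anti_depth (anc_trans (anc_par z) zb) xb _.
  by have := depth_par zr; rewrite dz => -[].
have zvv w : anc b w -> anc z w by move=> bw; apply: anc_trans zb bw.
have eqz y : y \in children x -> y \in lines [:: v; v'] -> y = z.
  by move=> yc; rewrite inS // => /orP[] yw; apply: (sameline _ _ _ yc zc yw); apply: zvv.
apply: sum_le_unique => //; first exact: uniq_children.
  by move=> y y' yc yc' yS yS'; rewrite (eqz y) // (eqz y').
move=> y yc yS; rewrite (eqz y) // /fork zb xb.
by rewrite (ratio_child lambda_gt0 xr zc).
Qed.

(** The quotients [fork b u / ratio u] telescope along an arm to at most 2, and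
    each of them is at least 1 and occurs at most [M.+1] times. *)
Lemma fork_arm M b v : (forall u, (m u <= M)%N) -> anc b v ->
  \prod_(u <- line v | ~~ anc u b) fork b u ^+ debt0 u <=
  2 ^+ M.+1 * \prod_(u <- line v | ~~ anc u b) ratio u ^+ debt0 u.
Proof.
move=> mM; have [->|br] := eqVneq b root => bv.
  apply: (@le_trans _ _ (\prod_(u <- line v | ~~ anc u root) ratio u ^+ debt0 u)).
    apply: ler_prod => u nu; rewrite exprn_ge0 /=; last by case/andP: (fork_le1 root u).
    by rewrite /fork (negPf nu) depth_root resistance0 !add0r.
  apply: ler_peMl; last by rewrite exprn_ege1 // ler1n.
  by apply: prodr_ge0 => u _; rewrite exprn_ge0 //; case/andP: (ratio_le1 lambda_gt0 u).
pose rb := resistance (depth b).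
have rb0 : 0 < rb by rewrite resistance_gt0 // depth_gt0.
pose c u := 2 * resistance (depth u) / (rb + resistance (depth u)).
suff H x : anc b x -> \prod_(u <- line x | ~~ anc u b) fork b u ^+ debt0 u <=
    c x ^+ M.+1 * \prod_(u <- line x | ~~ anc u b) ratio u ^+ debt0 u.
  apply: le_trans (H v bv) _; apply: ler_wpM2r.
    by apply: prodr_ge0 => u _; rewrite exprn_ge0 //; case/andP: (ratio_le1 lambda_gt0 u).
  have d0 : 0 < rb + resistance (depth v) by rewrite ltr_wpDr // resistance_ge0.
  apply: lerXn2r; rewrite ?nnegrE ?divr_ge0 ?mulr_ge0 ?resistance_ge0 ?(ltW d0) //.
  by rewrite ler_pdivrMr // ler_pM2l // lerDr ltW.
elim/par_ind: x => [|x xr IH] bx; first by move: br; rewrite -anc_rootr bx.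
have [bex|bnx] := eqVneq b x.
  rewrite -bex !big1_seq ?mulr1; last 2 first.
  - by move=> u /andP[nu]; rewrite mem_line => /andP[_ ub]; rewrite ub in nu.
  - by move=> u /andP[nu]; rewrite mem_line => /andP[_ ub]; rewrite ub in nu.
  have -> : c b = 1; last by rewrite expr1n.
  by rewrite /c -/rb; field; rewrite gt_eqF // addr_gt0.
have bp : anc b (par x) by apply: anc_par_proper.
have dbx : (depth b < depth x)%N.
  rewrite ltnNge; apply: contra bnx => d; exact/eqP/anc_eq.
have nxb : ~~ anc x b by apply/negP => /anc_depth; rewrite leqNgt dbx.
have b1 : (0 < depth b)%N by rewrite depth_gt0.
rewrite lineE // !big_cons nxb debt0_gt1; last by lia.
have px : (depth x).-1 = depth (par x) by rewrite (depth_par xr).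
have pgt : (0 < depth (par x))%N by rewrite -px; lia.
have r1 : 0 < resistance (depth (par x)) by rewrite resistance_gt0.
have r2 : 0 < resistance (depth x) by rewrite resistance_gt0 // (depth_par xr).
have d1 : 0 < rb + resistance (depth (par x)) by rewrite ltr_wpDr // ltW.
have d2 : 0 < rb + resistance (depth x) by rewrite ltr_wpDr // ltW.
have le12 : resistance (depth (par x)) <= resistance (depth x).
  by rewrite (depth_par xr) resistanceS lerDl exprn_ge0 // ltW.
have cp0 : 0 < c (par x) by rewrite divr_gt0 // mulr_gt0.
have [q [q1 fq ->]] : exists q, [/\ 1 <= q, fork b x = ratio x * q &
    c x = q * c (par x)].
  exists (c x / c (par x)); split; last by rewrite divfK // gt_eqF.
    rewrite ler_pdivlMr // mul1r /c ler_pdivlMr // mulrAC ler_pdivrMr //.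
    have := ler_wpM2l (ltW rb0) le12; rewrite /rb; lra.
  rewrite /fork (negPf nxb) /c /ratio px -/rb; field.
  by rewrite !gt_eqF.
rewrite fq [X in X * _ <= _]exprMn [X in _ <= X * _]exprMn.
rewrite [leRHS]mulrACA [q ^+ M.+1 * _]mulrC.
apply: ler_pM.
- apply: mulr_ge0; rewrite exprn_ge0 //; first by case/andP: (ratio_le1 lambda_gt0 x).
  by rewrite (le_trans ler01).
- by apply: prodr_ge0 => u _; rewrite exprn_ge0 //; case/andP: (fork_le1 b u).
- apply: ler_wpM2l; first by rewrite exprn_ge0 //; case/andP: (ratio_le1 lambda_gt0 x).
  by rewrite ler_weXn2l // ltnS.
- exact: IH.
Qed.

Lemma Psi_split b v : anc b v ->
  Psi v = Psi b * \prod_(u <- line v | ~~ anc u b) ratio u ^+ debt0 u.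
Proof.
move=> bv; rewrite /Psi (bigID (fun u => anc u b)) /=; congr (_ * _).
rewrite -big_filter; apply: perm_big; apply: uniq_perm.
- by rewrite filter_uniq // uniq_line.
- exact: uniq_line.
move=> u; rewrite mem_filter !mem_line; case: (eqVneq u root) => _ /=; rewrite ?andbF //.
by case ub : (anc u b) => //=; rewrite (anc_trans ub bv).
Qed.

(** The stem contributes [Psi b], and the arm towards [v] contributes
    [Psi v / Psi b] up to the price of counting the stem twice. *)
Lemma expect_two_dug_le M b v v' n : (forall u, (m u <= M)%N) ->
  (forall u, anc u b = anc u v && anc u v') -> v != root -> v' != root ->
  expect n (fun h => (dug (stopped h) v && dug (stopped h) v')%:R) <=
  4 ^+ M.+1 * (Psi v * Psi v' / Psi b).
Proof.
move=> mM bP vr v'r.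
have bv : anc b v by move: (anc_refl b); rewrite bP => /andP[].
have bv' : anc b v' by move: (anc_refl b); rewrite bP => /andP[].
have := @expect_all_dug_le _ _ T_lf _ _ lambda_gt0 m_root T_infinite
  [:: v; v'] (fork b) n (fork_le1 b) (fun u _ => @fork_gt0 b u) (fork_super bP).
rewrite !inE !(eq_sym root) negb_or vr v'r => /(_ isT) le1.
under eq_fun do rewrite -[dug _ v']andbT.
apply: le_trans le1 _; rewrite (bigID (fun u => anc u b)) /=.
have -> : \prod_(u <- lines [:: v; v'] | anc u b) fork b u ^+ debt0 u = Psi b.
  rewrite /Psi -big_filter (perm_big (line b)) /=.
    rewrite big_seq [RHS]big_seq; apply: eq_bigr => u; rewrite mem_line => /andP[_ ub].
    by rewrite /fork ub.
  apply: uniq_perm; rewrite ?uniq_line ?filter_uniq ?undup_uniq // => u.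
  rewrite mem_filter mem_lines mem_line /= orbF bP.
  by case: (anc u v); case: (anc u v'); case: (u != root).
have arms : \prod_(u <- lines [:: v; v'] | ~~ anc u b) fork b u ^+ debt0 u <=
  \prod_(u <- line v | ~~ anc u b) fork b u ^+ debt0 u *
  \prod_(u <- line v' | ~~ anc u b) fork b u ^+ debt0 u.
  rewrite -!(big_filter (line _)) -big_cat -big_filter /= (perm_big _ (_ : perm_eq _ 
    ([seq u <- line v | ~~ anc u b] ++ [seq u <- line v' | ~~ anc u b]))) //.
  apply: uniq_perm.
  - by rewrite filter_uniq // undup_uniq.
  - rewrite cat_uniq !filter_uniq ?uniq_line // andbT /=.
    apply/hasPn => u; rewrite !mem_filter !mem_line => /and3P[nu ur uv'].
    by rewrite ur nu /=; apply: contra nu => uv; rewrite bP uv.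
  move=> u; rewrite mem_cat !mem_filter mem_lines !mem_line /= orbF.
  by case: (u != root); case: (anc u v); case: (anc u v'); case: (anc u b).
have P0 := @Psi_gt0 _ T _ m lambda_gt0.
have fork0 w : 0 <= \prod_(u <- line w | ~~ anc u b) fork b u ^+ debt0 u.
  by apply: prodr_ge0 => u _; rewrite exprn_ge0 //; case/andP: (fork_le1 b u).
apply: le_trans (ler_wpM2l (ltW (P0 b)) arms) _.
have two := ler_pM (fork0 v) (fork0 v') (fork_arm mM bv) (fork_arm mM bv').
apply: le_trans (ler_wpM2l (ltW (P0 b)) two) _.
rewrite (Psi_split bv) (Psi_split bv').
rewrite mulrACA -exprMn -natrM le_eqVlt; apply/orP; left; apply/eqP.
by field; rewrite gt_eqF.
Qed.

(** On a single line [ratio] is balanced as it stands, so that the bound holds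
    without a constant. *)
Lemma expect_dug_le v n : v != root ->
  expect n (fun h => (dug (stopped h) v)%:R) <= Psi v.
Proof.
move=> vr; have := @expect_all_dug_le _ _ T_lf _ _ lambda_gt0 m_root T_infinite
  [:: v] ratio n (ratio_le1 lambda_gt0) (fun u _ => @ratio_gt0 _ _ _ lambda_gt0 u).
have pl : perm_eq (lines [:: v]) (line v).
  apply: uniq_perm; rewrite ?undup_uniq ?uniq_line // => u.
  by rewrite mem_lines mem_line /= orbF.
rewrite (perm_big _ pl) inE eq_sym (negPf vr) => H.
under eq_fun do rewrite -[dug _ v]andbT.
apply: H => // x; rewrite mem_lines => /andP[xr _].
apply: sum_le_unique; rewrite ?uniq_children //.
- by rewrite mulr_ge0 ?(ltW lambda_gt0) // subr_ge0; case/andP: (ratio_le1 lambda_gt0 x).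
- move=> y z yc zc; rewrite !mem_lines /= !orbF => /andP[_ yv] /andP[_ zv].
  by apply: anc_anti_depth yv zv _; rewrite (child_depth yc) (child_depth zc).
- by move=> y yc _; rewrite (ratio_child lambda_gt0 xr yc).
Qed.

End PairBound.

(** * A lower bound for digging one vertex *)

Section LowerBound.
Variables (R : realType) (T : rootedTree) (T_lf : locally_finite_tree T).
Variables (lambda : R) (m : T -> nat).
Hypothesis lambda_gt0 : 0 < lambda.
Hypothesis m_root : m troot = 0%N.
Hypothesis T_infinite : infinite_set [set: T].
Implicit Types (x y u v w b : T) (h : seq T).
Local Notation root := (@troot T).
Local Notation children := (children T_lf).
Local Notation dug := (dug m).
Local Notation valid := (valid T_lf m).
Local Notation step := (step T_lf lambda m).
Local Notation expect := (expect T_lf lambda m).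
Local Notation returned := (returned m).
Local Notation stopped := (stopped m).
Local Notation potential := (potential m).
Local Notation some_dug := (some_dug m).
Local Notation ratio := (ratio lambda).
Local Notation Psi := (Psi lambda m).

Variables (v w : T).
Hypothesis wv : anc w v.
Hypothesis w1 : depth w = 1%N.

Let kappa : R := (size (children root))%:R^-1.

(** An excursion explores only the subtree of the first vertex of depth one that
    it digs, and this has to be [w]. *)
Definition on_course h : bool := ~~ some_dug h || (dug h w && anc w (pos h)).

(** Choosing [w] at each visit to the root, with probability [kappa], digs [w]
    first; from then on the potential of the line of [v] is a martingale. *)
Definition prospect h : R :=
  if dug h v then 1
  else if on_course h
  then kappa ^+ ((m w).+1 - count_mem w h) * potential (line v) predT ratio h
  else 0.

Lemma kappa_ge0 : 0 <= kappa.
Proof. by rewrite invr_ge0. Qed.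

Lemma kappa_le1 : kappa <= 1.
Proof.
by rewrite invf_le1 ?ltr0n ?ler1n ?(size_children_root T_lf T_infinite).
Qed.

Lemma w_neq_root : w != root.
Proof. by rewrite -depth_gt0 w1. Qed.

Lemma par_w : par w = root.
Proof. by apply/eqP; rewrite -depth_eq0; have := depth_par w_neq_root; rewrite w1 => -[<-]. Qed.

Lemma v_neq_root : v != root.
Proof. by apply: contraTneq wv => ->; rewrite anc_rootr w_neq_root. Qed.

Lemma potential_bounds h : 0 <= potential (line v) predT ratio h <= 1.
Proof.
rewrite potential_le1; last by move=> u; exact: ratio_le1.
by rewrite andbT potential_ge0 // => u; case/andP: (ratio_le1 lambda_gt0 u).
Qed.

Lemma prospect_bounds h : 0 <= prospect h <= 1.
Proof.
rewrite /prospect; have /andP[p0 p1] := potential_bounds h.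
case: ifP => _; first by rewrite ler01 lexx.
case: ifP => _; last by rewrite lexx ler01.
by rewrite mulr_ge0 ?exprn_ge0 ?kappa_ge0 //= mulr_ile1 ?exprn_ge0 ?exprn_ile1 ?kappa_ge0 ?kappa_le1.
Qed.

(** Among the children of a vertex of the line only the next vertex of the line
    contributes, and [ratio_child] is an equality. *)
Lemma line_balance h : valid h -> pos h != root -> pos h != v ->
  lambda * (factor (line v) predT ratio (pos h) - 1) +
  \sum_(y <- children (pos h)) ((factor (line v) predT ratio y)^-1 - 1) = 0.
Proof.
set x := pos h => vh xr xv; rewrite /factor !andbT.
have nx y : y \in children x -> (y \in line v) = anc y v.
  by move=> yc; rewrite mem_line (child_neq_root yc).
case: ifP => [|xl].
  rewrite mem_line xr /= => xv'.
  pose z := iter (depth v - (depth x).+1) par v.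
  have dxv : (depth x < depth v)%N.
    by rewrite ltnNge; apply: contra xv => d; apply/eqP/anc_eq.
  have zv : anc z v by apply/ancP; eexists.
  have dz : depth z = (depth x).+1.
    by rewrite depth_iter_par subKn.
  have zr : z != root by rewrite -depth_gt0 dz.
  have zc : z \in children x.
    rewrite mem_children zr /=; apply/eqP.
    apply: anc_anti_depth (anc_trans (anc_par z) zv) xv' _.
    by have := depth_par zr; rewrite dz => -[].
  rewrite (bigD1_seq z) ?uniq_children //= nx // zv (ratio_child lambda_gt0 xr zc).
  rewrite big_seq_cond big1 => [|y /andP[yc yz]]; first by ring.
  rewrite nx //; case: ifP => [/andP[yv _]|_]; last by rewrite invr1 subrr.
  case/eqP: yz; apply: anc_anti_depth yv zv _.
  by rewrite (child_depth yc) (child_depth zc).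
rewrite subrr mulr0 add0r big_seq big1 // => y yc; rewrite nx //.
case: ifP => [/andP[yv _]|_]; last by rewrite invr1 subrr.
case/negP: xl; rewrite mem_line xr /=; apply: anc_trans yv.
by rewrite -(child_par yc) anc_par.
Qed.

Lemma prospect_step h : valid h -> ~~ returned h -> prospect h <= step h prospect.
Proof.
move=> vh nrh; have P01 := prospect_bounds.
have [dv|ndv] := boolP (dug h v).
  have -> : prospect h = step h (fun=> prospect h).
    by rewrite (step_cst lambda_gt0 m_root T_infinite).
  apply: (step_le lambda_gt0 m_root vh) => y _.
  by rewrite /prospect dv dug_cons.
have [oc|noc] := boolP (on_course h); last first.
  have -> : prospect h = step h (fun=> prospect h).
    by rewrite (step_cst lambda_gt0 m_root T_infinite).
  apply: (step_le lambda_gt0 m_root vh) => y _.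
  by rewrite {1}/prospect (negPf ndv) (negPf noc); case/andP: (P01 (y :: h)).
have Ph : prospect h = kappa ^+ ((m w).+1 - count_mem w h) * potential (line v) predT ratio h.
  by rewrite /prospect (negPf ndv) oc.
have /andP[pot0 pot1] := potential_bounds h.
have ratpos u : u \in line v -> predT u -> (1 < depth u)%N -> 0 < ratio u.
  by move=> _ _; exact: ratio_gt0.
(* It is enough to stay on course with as many visits and as much potential. *)
have weak h' : on_course h' -> (count_mem w h <= count_mem w h')%N ->
    potential (line v) predT ratio h <= potential (line v) predT ratio h' ->
    prospect h <= prospect h'.
  move=> oc' cw ple; rewrite Ph /prospect.
  have /andP[pot0' pot1'] := potential_bounds h'.
  have k1 : kappa ^+ ((m w).+1 - count_mem w h) <= kappa ^+ ((m w).+1 - count_mem w h').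
    by rewrite ler_wiXn2l ?kappa_ge0 ?kappa_le1 // leq_sub2l.
  case: ifP => _; last by rewrite oc' ler_pM ?exprn_ge0 ?kappa_ge0.
  by rewrite mulr_ile1 ?exprn_ge0 ?exprn_ile1 ?kappa_ge0 ?kappa_le1.
have [dx|ndx] := boolP (dug h (pos h)); last first.
  have xr := pos_root_dug m_root vh ndx.
  have dp := valid_dug_par vh (pos_mem vh) xr.
  rewrite (step_undug lambda m_root _ vh ndx); apply: weak.
  - case/orP: oc => [nsd|/andP[dw wx]]; apply/orP.
      left; have pr : par (pos h) = root.
        apply/eqP; apply: contraR nsd => pr; apply/some_dugP; by exists (par (pos h)).
      apply/some_dugP => -[u ur]; rewrite pr dug_cons_neq // => du.
      by case/some_dugP: nsd; exists u.
    right; rewrite dug_cons //=; apply: anc_par_proper => //.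
    by apply: contraNneq ndx => <-.
  - by rewrite /= leq_addl.
  - by rewrite (potential_undug m_root _ _ (uniq_line v) vh ndx).
have [xr|xr] := eqVneq (pos h) root.
  rewrite (step_root lambda m_root _ vh xr).
  have nd u : u != root -> ~~ dug h u by exact: root_undug vh nrh xr.
  have wc : w \in children (pos h) by rewrite mem_children w_neq_root par_w xr eqxx.
  apply: (@le_trans _ _ (kappa * prospect (w :: h))); last first.
    rewrite mulrC ler_wpM2r ?kappa_ge0 // -xr (big_rem w) //= lerDl.
    by apply: sumr_ge0 => y _; case/andP: (P01 (y :: h)).
  have cw : (count_mem w h <= m w)%N.
    by move: (nd w w_neq_root); rewrite /dug -leqNgt.
  rewrite Ph subSn // exprS -mulrA ler_wpM2l ?kappa_ge0 //.
  rewrite /prospect /= eqxx add1n subSS.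
  case: ifP => _; first by rewrite mulr_ile1 ?exprn_ge0 ?exprn_ile1 ?kappa_ge0 ?kappa_le1.
  have -> : on_course (w :: h).
    rewrite /on_course /= anc_refl andbT orbC.
    case dw : (dug (w :: h) w) => //=; apply/some_dugP => -[u ur du].
    have uw : u != w by apply: contraFneq dw => uw; rewrite uw in du.
    by move: du; rewrite dug_cons_neq // (negPf (nd _ ur)).
  by rewrite (potential_child (uniq_line v) vh nrh wc) // xr eqxx andbF mulr1.
have sd : some_dug h by apply/some_dugP; exists (pos h).
have [dw wx] : dug h w /\ anc w (pos h) by apply/andP; move: oc; rewrite /on_course sd.
have xv : pos h != v by apply: contraNneq ndv => <-.
have k1 h' : dug h' w -> kappa ^+ ((m w).+1 - count_mem w h') = 1.
  by rewrite /dug -subn_eq0 => /eqP ->.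
have -> : prospect h = step h (potential (line v) predT ratio).
  rewrite (step_potential lambda_gt0 (uniq_line v) vh nrh ratpos dx xr).
  by rewrite line_balance // mul0r addr0 mulr1 Ph k1 // mul1r.
apply: (step_le lambda_gt0 m_root vh) => y vyh.
have [oc'|noc'] := boolP (on_course (y :: h)).
  rewrite /prospect oc'; case: ifP => _; first by case/andP: (potential_bounds (y :: h)).
  by rewrite k1 ?dug_cons // mul1r.
(* Leaving the course means stepping from [w] down to the root, where the
   potential vanishes because [ratio w = 0]. *)
move: vyh; rewrite (valid_cons _ _ _ (valid_neq0 vh)) vh /=.
case: ifP => [yc _|_ /andP[_ /eqP ye]].
  case/negP: noc'; apply/orP; right; rewrite dug_cons //=.
  by apply: (anc_trans wx); rewrite -(child_par yc) anc_par.
have xw : pos h = w.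
  apply/eqP; apply: contraR noc' => xw; apply/orP; right.
  by rewrite dug_cons //= ye anc_par_proper // eq_sym.
rewrite ye (potential_par _ _ (uniq_line v) vh xr dx) xw /factor mem_line.
have rw0 : ratio w = 0 by rewrite /ratio w1 /= resistance0 mul0r.
rewrite w_neq_root wv /= rw0 mulr0.
by case/andP: (P01 (par w :: h)).
Qed.

(** The submartingale [prospect] is one when [v] is dug, zero at the return
    otherwise, and at most one in the meantime. *)
Lemma expect_dug_ge n :
  kappa ^+ (m w).+1 * Psi v <=
  expect n (fun h => (dug (stopped h) v)%:R) +
  expect n (fun h => (~~ returned h)%:R).
Proof.
pose F h := prospect (stopped h).
have -> : kappa ^+ (m w).+1 * Psi v = F [:: root].
  rewrite /F /= /prospect /dug /= eq_sym (negPf v_neq_root).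
  have -> : on_course [:: root].
    apply/orP; left; apply/some_dugP => -[u ur]; rewrite /dug /= eq_sym.
    by rewrite (negPf ur).
  rewrite eq_sym (negPf w_neq_root) subn0; congr (_ * _).
  rewrite /Psi /potential big_seq [RHS]big_seq; apply: eq_bigr => u.
  by rewrite mem_line => /andP[ur _]; rewrite debt_start.
rewrite -expectD //; apply: (@le_trans _ _ (expect n F)).
  apply: (expect_submart lambda_gt0 m_root) => h vh.
  apply: (step_stopped_ge lambda_gt0 m_root T_infinite vh); exact: prospect_step.
apply: (expect_le lambda_gt0 m_root) => h vh _.
have /andP[p0 p1] := prospect_bounds (stopped h); rewrite /F.
have [dv|ndv] := boolP (dug (stopped h) v); first by apply: (le_trans p1); rewrite lerDl.
rewrite add0r; have [rh|nrh] := boolP (returned h); last exact: p1.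
have [pr sd] := returned_stopped rh.
by rewrite /prospect (negPf ndv) /on_course sd pr anc_rootr (negPf w_neq_root) andbF.
Qed.

End LowerBound.

(** * Return or escape from finitely many levels *)

Section Confinement.
Variables (R : realType) (T : rootedTree) (T_lf : locally_finite_tree T).
Variables (lambda : R) (m : T -> nat).
Hypothesis lambda_gt0 : 0 < lambda.
Hypothesis m_root : m troot = 0%N.
Hypothesis T_infinite : infinite_set [set: T].
Implicit Types (x y u v w b : T) (h : seq T).
Local Notation root := (@troot T).
Local Notation children := (children T_lf).
Local Notation dug := (dug m).
Local Notation valid := (valid T_lf m).
Local Notation step := (step T_lf lambda m).
Local Notation expect := (expect T_lf lambda m).
Local Notation returned := (returned m).
Local Notation some_dug := (some_dug m).
Variable N : nat.
Local Notation level := (level T_lf).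

Definition confined h : bool :=
  ~~ returned h && all (fun v => ~~ dug h v) (level N).

Lemma confined_cons y h : confined (y :: h) -> confined h.
Proof.
move=> /andP[]; rewrite /= negb_or => /andP[nr _] /allP nd.
apply/andP; split => //; apply/allP => v vN.
by apply: contra (nd v vN); apply: dug_cons.
Qed.

Lemma confined_depth h : valid h -> confined h -> (depth (pos h) <= N)%N.
Proof.
move=> vh /andP[_ /allP nd]; rewrite leqNgt; apply/negP => d.
pose u := iter (depth (pos h) - N) par (pos h).
have du : depth u = N by rewrite depth_iter_par subKn // ltnW.
have uN : u \in level N by rewrite mem_level du.
have au : anc u (pos h) by apply/ancP; eexists.
case/negP: (nd u uN); apply: valid_dug_anc vh (pos_mem vh) au _.
by apply: contraTneq d => <-; rewrite du ltnn.
Qed.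

(* [D] bounds the numbers of children up to level [N], so that [p] bounds from
   below the probability of a step to the parent; the increments of [Gam]
   decrease fast enough for such a step to outweigh all steps to children. *)
Let D : nat := (\max_(x <- flatten [seq level k | k <- iota 0 N.+1]) size (children x))%N.
Let p : R := lambda / (lambda + D%:R).
Let a : R := p / 2.
Let delta : R := a ^+ N.+1.
Let Gam d : R := \sum_(i < d) a ^+ i.+1.
Let S : nat := (\sum_(y <- children root) m y)%N.
Let Q h : nat := (\sum_(y <- children root) count_mem y h)%N.

(** A Lyapunov function. Once a vertex other than the root is dug it is a concave
    function of the depth. Before, the walk alternates between the root and its
    children, and at most [S - Q h] visits to a child are left without a dig;
    the factor 3 makes the steps in both directions decrease the height. *)
Definition height h : R :=
  if some_dug h then Gam (depth (pos h))
  else a + delta + delta * (3 * (S - Q h) + depth (pos h))%:R.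

Lemma size_children_le x : (depth x <= N)%N -> (size (children x) <= D)%N.
Proof.
move=> dx; have xin : x \in flatten [seq level k | k <- iota 0 N.+1].
  by apply/flatten_mapP; exists (depth x); rewrite ?mem_level // mem_iota.
by rewrite /D (big_rem x) //= leq_maxl.
Qed.

Lemma p_gt0 : 0 < p.
Proof. by rewrite divr_gt0 // ltr_wpDr. Qed.

Lemma p_le1 : p <= 1.
Proof. by rewrite ler_pdivrMr ?ltr_wpDr // mul1r lerDl. Qed.

Lemma a_gt0 : 0 < a.
Proof. by rewrite divr_gt0 // p_gt0. Qed.

Lemma a_le1 : a <= 1.
Proof. by rewrite ler_pdivrMr // mul1r (le_trans p_le1) // ler1n. Qed.

Lemma delta_gt0 : 0 < delta.
Proof. by rewrite exprn_gt0 // a_gt0. Qed.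

Lemma Gam_ge0 d : 0 <= Gam d.
Proof. by apply: sumr_ge0 => i _; rewrite exprn_ge0 // ltW // a_gt0. Qed.

Lemma GamS d : Gam d.+1 = Gam d + a ^+ d.+1.
Proof. by rewrite /Gam big_ord_recr. Qed.

Lemma delta_le d : (d <= N)%N -> delta <= a ^+ d.+1.
Proof. by move=> dN; rewrite ler_wiXn2l ?a_le1 ?(ltW a_gt0). Qed.

Lemma height_ge0 h : 0 <= height h.
Proof.
rewrite /height; case: ifP => _; first exact: Gam_ge0.
have d0 := ltW delta_gt0; apply: addr_ge0; first exact: addr_ge0 (ltW a_gt0) d0.
exact: mulr_ge0 d0 (ler0n _ _).
Qed.

Lemma step_confined h : valid h ->
  step h (fun h' => (confined h')%:R * height h') <=
  (confined h)%:R * height h - delta * (confined h)%:R.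
Proof.
move=> vh; have [cf|ncf] := boolP (confined h); last first.
  rewrite !mul0r mulr0 subr0 -[leRHS](step_cst lambda_gt0 m_root T_infinite 0 vh).
  apply: (step_le lambda_gt0 m_root vh) => y _.
  by have /negPf -> : ~~ confined (y :: h) by [apply: contra ncf; apply: confined_cons];
    rewrite mul0r.
rewrite mul1r mulr1.
have dN := confined_depth vh cf.
have a0 := a_gt0; have a1 := a_le1; have d0 := delta_gt0.
have [sd|nsd] := boolP (some_dug h).
  have xr : pos h != root.
    apply: contraTneq sd => xr; apply/some_dugP => -[u ur].
    by apply/negP; apply: root_undug vh _ xr ur; case/andP: cf.
  pose f h' : R := Gam (depth (pos h')).
  apply: (@le_trans _ _ (step h f)).
    apply: (step_le lambda_gt0 m_root vh) => y _.
    case: (confined _); rewrite ?mul0r ?Gam_ge0 // mul1r.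
    by rewrite /height some_dug_cons.
  rewrite /height sd.
  have [d dE] : exists d, depth (pos h) = d.+1.
    by have := xr; rewrite -depth_gt0; case: (depth _) => // d _; exists d.
  have pd : depth (par (pos h)) = d by have := depth_par xr; rewrite dE => -[].
  have [dx|ndx] := boolP (dug h (pos h)); last first.
    rewrite (step_undug lambda m_root _ vh ndx) /f /= pd dE GamS.
    have := delta_le (ltnW (leq_trans (leqnn _) _ : (d < N)%N)).
    by rewrite -dE dN => /(_ isT); lra.
  rewrite (step_dug T_lf lambda f dx xr) {1}/f /= pd.
  have -> : \sum_(y <- children (pos h)) f (y :: h) =
      (size (children (pos h)))%:R * (Gam d.+1 + a ^+ d.+2).
    rewrite mulr_natl -iter_addr_0 -(count_predT (children _)) -big_const_seq.
    rewrite big_seq [RHS]big_seq; apply: eq_bigr => y yc.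
    by rewrite /f /= (child_depth yc) dE GamS.
  rewrite ler_pdivrMr ?den_gt0 // dE GamS.
  have cD := size_children_le dN.
  set c := (size (children (pos h)))%:R.
  have cD' : c <= D%:R by rewrite ler_nat.
  have c0 : 0 <= c by exact: ler0n.
  (* [p (lambda + c) <= lambda], as [D] is at least the number of children *)
  have pc : p * (lambda + c) <= lambda.
    by rewrite /p mulrAC ler_pdivrMr ?ltr_wpDr // ler_pM2l // lerD2l.
  have de : delta <= a ^+ d.+2 by apply: delta_le; rewrite -dE.
  have ap : a ^+ d.+2 = a ^+ d.+1 * (p / 2) by rewrite exprSr.
  have aa : 0 < a ^+ d.+1 by rewrite exprn_gt0.
  have h1 : delta * (lambda + c) <= a ^+ d.+2 * (lambda + c).
    by rewrite ler_wpM2r // addr_ge0 // ltW.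
  have h2 : a ^+ d.+1 * (p * (lambda + c)) <= a ^+ d.+1 * lambda.
    by rewrite ler_pM2l.
  have h3 : 0 <= a ^+ d.+2 * lambda by rewrite mulr_ge0 ?exprn_ge0 // ltW.
  have h4 : a ^+ d.+2 * (lambda + c) + a ^+ d.+2 * (lambda + c) = a ^+ d.+1 * (p * (lambda + c)).
    by rewrite ap; field.
  lra.
have nd u : u != root -> ~~ dug h u.
  by move=> ur; apply: contra nsd => du; apply/some_dugP; exists u.
have QS : (Q h <= S)%N.
  rewrite /Q /S big_seq [leqRHS]big_seq; apply: leq_sum => y yc.
  by have := nd y (child_neq_root yc); rewrite /dug -leqNgt.
have Hh : height h = a + delta + delta * (3 * (S - Q h) + depth (pos h))%:R.
  by rewrite /height (negPf nsd).
have [xr|xr] := eqVneq (pos h) root; last first.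
  have ndx := nd _ xr.
  have pr : par (pos h) = root.
    apply/eqP; apply: contraR nsd => pr; apply/some_dugP; exists (par (pos h)) => //.
    exact: valid_dug_par vh (pos_mem vh) xr.
  rewrite (step_undug lambda m_root _ vh ndx) pr.
  have nsd' : some_dug (root :: h) = false.
    apply/some_dugP => -[u ur]; rewrite dug_cons_neq //.
    by apply/negP; exact: nd.
  have Q' : Q (root :: h) = Q h.
    rewrite /Q big_seq [RHS]big_seq; apply: eq_bigr => y yc /=.
    by rewrite eq_sym (negPf (child_neq_root yc)).
  have H' : height (root :: h) = a + delta + delta * (3 * (S - Q h))%:R.
    by rewrite /height nsd' Q' /= depth_root addn0.
  rewrite Hh (depth_par xr) pr depth_root natrD mulrDr mulr1.
  have := height_ge0 (root :: h); rewrite H'.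
  by case: (confined _); rewrite ?mul0r ?mul1r; move: d0; lra.
rewrite -[leRHS](step_cst lambda_gt0 m_root T_infinite _ vh).
apply: (step_le lambda_gt0 m_root vh) => y.
rewrite (valid_cons _ _ _ (valid_neq0 vh)) => /andP[_].
case: ifP => [yc _|_]; last by rewrite xr eqxx.
have hy : height (y :: h) <= height h - delta.
  rewrite Hh {1}/height; case: ifP => [_|sdy].
    rewrite /= (child_depth yc) xr depth_root GamS /Gam big_ord0 add0r expr1.
    have : 0 <= delta * (3 * (S - Q h) + 0)%:R by rewrite mulr_ge0 // ltW.
    by lra.
  have ndy u : u != root -> ~~ dug (y :: h) u.
    by move=> ur; apply/negP => du; case/some_dugP: sdy; exists u.
  have yc' : y \in children root by rewrite -xr.
  have Q' : Q (y :: h) = (Q h).+1.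
    rewrite /Q (bigD1_seq y) ?uniq_children //= eqxx [in RHS](bigD1_seq y) ?uniq_children //=.
    rewrite add1n addSn; congr (_ + _).+1; apply: eq_bigr => z zy.
    by rewrite eq_sym (negPf zy).
  have QS' : (Q (y :: h) <= S)%N.
    rewrite /Q /S big_seq [leqRHS]big_seq; apply: leq_sum => z zc.
    by have := ndy z (child_neq_root zc); rewrite /dug -leqNgt.
  rewrite /= (child_depth yc) xr depth_root Q'.
  have -> : (3 * (S - Q h) + 0)%N%:R = (3 * (S - (Q h).+1) + 1)%N%:R + 2 :> R.
    by rewrite -natrD; congr (_%:R); lia.
  by rewrite mulrDr; lra.
have := height_ge0 h; have := height_ge0 (y :: h).
have : 0 <= delta * (3 * (S - Q h) + depth (pos h))%:R by rewrite mulr_ge0 // ltW.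
by case: (confined _); rewrite ?mul0r ?mul1r //; rewrite Hh; lra.
Qed.

(** The time spent before returning to the root or digging level [N] has a
    bounded expectation, so its tail at [n] is of order [1 / n]. *)
Lemma expect_confined : exists C : R, forall n,
  n%:R * expect n (fun h => (confined h)%:R) <= C.
Proof.
pose f h : R := (confined h)%:R * height h.
have H n : delta * (n%:R * expect n (fun h => (confined h)%:R)) + expect n f <= f [:: root].
  elim: n => [|n IH]; first by rewrite mul0r mulr0 add0r.
  apply: le_trans IH.
  have e1 : expect n.+1 (fun h => (confined h)%:R) <= expect n (fun h => (confined h)%:R).
    rewrite /=; apply: (expect_le lambda_gt0 m_root) => h vh _.
    rewrite -[leRHS](step_cst lambda_gt0 m_root T_infinite _ vh).
    apply: (step_le lambda_gt0 m_root vh) => y _.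
    by rewrite ler_nat; case c: (confined (y :: h)) => //; rewrite (confined_cons c).
  have e2 : expect n.+1 f <= expect n f - delta * expect n (fun h => (confined h)%:R).
    rewrite -mulNr -expectZ // -expectD //=.
    apply: (expect_le lambda_gt0 m_root) => h vh _.
    by have := step_confined vh; rewrite mulNr.
  have e3 : n.+1%:R * expect n.+1 (fun h => (confined h)%:R) <=
     n.+1%:R * expect n (fun h => (confined h)%:R) by rewrite ler_wpM2l.
  have e4 := ler_wpM2l (ltW delta_gt0) e3.
  move: e4; rewrite -[in leRHS]natr1 mulrDl mul1r mulrDr; lra.
exists (f [:: root] / delta) => n; rewrite ler_pdivlMr ?delta_gt0 // mulrC.
apply: le_trans (H n); rewrite lerDl; apply: (expect_ge0 lambda_gt0 m_root T_infinite) => h _.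
by rewrite mulr_ge0 ?height_ge0.
Qed.

End Confinement.

(** * Cuts and flows on truncated trees *)

Section Flow.
Variables (R : realType) (T : rootedTree) (T_lf : locally_finite_tree T).
Variable wt : T -> R.
Hypothesis wt_ge0 : forall u, 0 <= wt u.
Implicit Types (x y u v : T).
Local Notation root := (@troot T).
Local Notation children := (children T_lf).
Local Notation level := (level T_lf).

(** On a tree the least weight of a cut between [u] and its descendants [n]
    generations later is computed recursively: cut at [u], or above each child
    separately. *)
Fixpoint cap n u : R :=
  if n is n'.+1 then Num.min (wt u) (\sum_(y <- children u) cap n' y) else wt u.

Fixpoint mincut n u : seq T :=
  if n is n'.+1 then
    if wt u <= \sum_(y <- children u) cap n' y then [:: u]
    else flatten [seq mincut n' y | y <- children u]
  else [:: u].

Lemma cap_ge0 n u : 0 <= cap n u.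
Proof.
elim: n u => [|n IH] u //=; rewrite le_min wt_ge0 /=.
by apply: sumr_ge0 => y _; apply: IH.
Qed.

Lemma cap_le n u : cap n u <= wt u.
Proof. by case: n => //= n; rewrite ge_min lexx. Qed.

Lemma capE n u : cap n u = \sum_(v <- mincut n u) wt v.
Proof.
elim: n u => [|n IH] u /=; first by rewrite big_seq1.
rewrite /Num.min; case: ltgtP => [lt|gt|e].
- by rewrite big_seq1.
- rewrite big_flatten big_map; apply: eq_bigr => y _; exact: IH.
- by rewrite big_seq1 e.
Qed.

Lemma mincut_anc n u v : v \in mincut n u -> anc u v.
Proof.
elim: n u => [|n IH] u /=; first by rewrite inE => /eqP ->; exact: anc_refl.
case: ifP => _; first by rewrite inE => /eqP ->; exact: anc_refl.
move=> /flatten_mapP[y yu /IH]; apply: anc_trans.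
by rewrite -(child_par yu) anc_par.
Qed.

Lemma mincut_child_uniq x y z v n k : y \in children x -> z \in children x ->
  v \in mincut n y -> v \in mincut k z -> y = z.
Proof.
move=> yx zx /mincut_anc yv /mincut_anc zv; apply: anc_anti_depth yv zv _.
by rewrite (child_depth yx) (child_depth zx).
Qed.

Lemma uniq_mincut n u : uniq (mincut n u).
Proof.
elim: n u => [|n IH] u //=; case: ifP => // _.
apply: uniq_flatten_children => // y z v yu zu; exact: (mincut_child_uniq yu zu).
Qed.

Lemma mincut_antichain n u v v' :
  v \in mincut n u -> v' \in mincut n u -> anc v v' -> v = v'.
Proof.
elim: n u => [|n IH] u /=; first by rewrite !inE => /eqP -> /eqP ->.
case: ifP => _; first by rewrite !inE => /eqP -> /eqP ->.
move=> /flatten_mapP[y yu vy] /flatten_mapP[y' yu' vy'] vv'.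
have e : y = y'.
  apply: anc_anti_depth (anc_trans (mincut_anc vy) vv') (mincut_anc vy') _.
  by rewrite (child_depth yu) (child_depth yu').
by rewrite -e in vy'; apply: IH vy vy' vv'.
Qed.

Lemma mincut_ray n u (nu : nat -> T) : ray nu -> nu (depth u) = u ->
  exists2 j, (depth u <= j)%N & nu j \in mincut n u.
Proof.
move=> nr; elim: n u => [|n IH] u nuu /=; first by exists (depth u); rewrite ?inE ?nuu.
case: ifP => _; first by exists (depth u); rewrite ?inE ?nuu.
set y := nu (depth u).+1.
have dy : depth y = (depth u).+1 by exact: ray_depth.
have yu : y \in children u by rewrite mem_children -depth_gt0 dy /= (ray_par nr) nuu.
have [|j dj jm] := IH y; first by rewrite dy.
by exists j; [apply: leq_trans dj; rewrite dy|apply/flatten_mapP; exists y].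
Qed.

Definition rootcut n : seq T := flatten [seq mincut n y | y <- children root].

Lemma uniq_rootcut n : uniq (rootcut n).
Proof.
apply: uniq_flatten_children => [y|y z v yr zr]; first exact: uniq_mincut.
exact: (mincut_child_uniq yr zr).
Qed.

Lemma rootcut_neq n v : v \in rootcut n -> v != root.
Proof.
move=> /flatten_mapP[y yr /mincut_anc yv].
by apply: contraTneq yv => ->; rewrite anc_rootr (child_neq_root yr).
Qed.

(** A ray crosses the cut above its vertex of depth one, and only once as this cut
    is an antichain. *)
Lemma cutset_rootcut n : cutset [set` [seq (par v, v) | v <- rootcut n]].
Proof.
split=> [e /= /mapP[v vc ->]|nu nr].
  by apply/edgesP; split => //; apply: rootcut_neq vc.
have n0 : nu 0%N = root by case: nr.
have inE' i : [set` [seq (par v, v) | v <- rootcut n]] (edge_of (nu i) (nu i.+1)) <->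
    nu i.+1 \in rootcut n.
  rewrite ray_edge //=; split=> [/mapP[v vc [_ ->]]//|vc].
  by apply/mapP; exists (nu i.+1); rewrite // ray_par.
set y := nu 1%N.
have yr : y \in children root by rewrite mem_children -depth_gt0 (ray_depth nr) /= (ray_par nr) n0.
have dy : depth y = 1%N by exact: ray_depth.
have [|j j1 jm] := @mincut_ray n y nu nr; first by rewrite dy.
rewrite dy in j1; have jc : nu j \in rootcut n by apply/flatten_mapP; exists y.
exists j; split; first by split => //; case: (j) j1 jc => // i _ /=; case: (inE' i).
move=> [|i] [i1 im] //; have {}im : nu i.+1 \in rootcut n by case: (inE' i) => h _; apply: h im.
have [z zr zm] : exists2 z, z \in children root & nu i.+1 \in mincut n z.
  by move/flatten_mapP: im.
have zy : z = y.
  apply: anc_anti_depth (mincut_anc zm) _ _; last by rewrite (child_depth zr) depth_root dy.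
  exact: ray_anc.
rewrite zy in zm.
have [ij|ji] := leqP i.+1 j.
  by rewrite -(ray_depth nr i.+1) (mincut_antichain zm jm (ray_anc nr ij)) ray_depth.
by rewrite -(ray_depth nr j) (mincut_antichain jm zm (ray_anc nr (ltnW ji))) ray_depth.
Qed.

Variable N : nat.

Definition room u : R := cap (N - depth u) u.

Definition supply : R := \sum_(y <- children root) room y.

(** At each vertex the flow is divided among the children in proportion to what
    can pass through them. *)
Fixpoint flow_rec k v : R :=
  if k is k'.+1 then
    flow_rec k' (par v) * (room v / \sum_(y <- children (par v)) room y)
  else supply.

Definition flow v : R := flow_rec (depth v) v.

Lemma room_ge0 u : 0 <= room u.
Proof. exact: cap_ge0. Qed.

Lemma room_le u : room u <= wt u.
Proof. exact: cap_le. Qed.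

Lemma flow_root : flow root = supply.
Proof. by rewrite /flow depth_root. Qed.

Lemma flowE v : v != root ->
  flow v = flow (par v) * (room v / \sum_(y <- children (par v)) room y).
Proof. by move=> vr; rewrite /flow {1}(depth_par vr). Qed.

Lemma flow_ge0 v : 0 <= flow v.
Proof.
elim/par_ind: v => [|v vr IH].
  by rewrite flow_root; apply: sumr_ge0 => y _; exact: room_ge0.
rewrite flowE // mulr_ge0 ?divr_ge0 ?room_ge0 //.
by apply: sumr_ge0 => y _; exact: room_ge0.
Qed.

Lemma sum_room_ge0 u : 0 <= \sum_(y <- children u) room y.
Proof. by apply: sumr_ge0 => y _; exact: room_ge0. Qed.

Lemma room_le_children u : (depth u < N)%N -> room u <= \sum_(y <- children u) room y.
Proof.
move=> du; rewrite /room -(subnSK du) /= ge_min.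
apply/orP; right; rewrite le_eqVlt; apply/orP; left; apply/eqP.
by apply: eq_big_seq => y yu; rewrite (child_depth yu).
Qed.

Lemma flow_le_room_of_par v : v != root ->
  flow (par v) <= \sum_(y <- children (par v)) room y -> flow v <= room v.
Proof.
move=> vr le; rewrite (flowE vr) mulrCA -[leRHS]mulr1 ler_wpM2l ?room_ge0 //.
have := sum_room_ge0 (par v); rewrite le_eqVlt => /orP[/eqP <-|S0].
  by rewrite invr0 mulr0 ler01.
by rewrite ler_pdivrMr // mul1r.
Qed.

Lemma flow_le_children u : (depth u < N)%N -> flow u <= \sum_(y <- children u) room y.
Proof.
elim/par_ind: u => [_|u ur IH du]; first by rewrite flow_root.
apply: le_trans (room_le_children du); apply: flow_le_room_of_par => //.
by apply: IH; rewrite -(depth_par ur) ltnW.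
Qed.

Lemma flow_le_room v : v != root -> (depth v <= N)%N -> flow v <= room v.
Proof.
move=> vr dv; apply: flow_le_room_of_par => //; apply: flow_le_children.
by rewrite -(depth_par vr).
Qed.

Lemma flow_conserved u : (depth u < N)%N -> \sum_(y <- children u) flow y = flow u.
Proof.
move=> du.
have -> : \sum_(y <- children u) flow y =
    flow u * ((\sum_(y <- children u) room y) / \sum_(y <- children u) room y).
  rewrite mulr_suml mulr_sumr; apply: eq_big_seq => y yu.
  by rewrite (flowE (child_neq_root yu)) (child_par yu).
have [S0|S0] := eqVneq (\sum_(y <- children u) room y) 0; last by rewrite divff // mulr1.
(* If nothing can pass above [u], then nothing reaches [u]. *)
rewrite S0 mul0r mulr0; apply/eqP; rewrite eq_le flow_ge0 /= -[leRHS]S0.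
exact: flow_le_children.
Qed.

Lemma flow_desc n u : (depth u + n = N)%N -> \sum_(v <- desc T_lf n u) flow v = flow u.
Proof.
elim: n u => [|n IH] u du; first by rewrite big_seq1.
rewrite /= big_flatten big_map -flow_conserved; last by rewrite -du; lia.
rewrite big_seq [RHS]big_seq; apply: eq_bigr => y yu; apply: IH.
by rewrite (child_depth yu); lia.
Qed.

Lemma flow_level u : (depth u <= N)%N ->
  \sum_(v <- level N | anc u v) flow v = flow u.
Proof.
move=> du; rewrite -big_filter -(subnKC du).
by rewrite (perm_big _ (@level_perm_desc _ T_lf (N - depth u) _ u erefl)) flow_desc ?subnKC.
Qed.

Lemma flow_total : \sum_(v <- level N) flow v = supply.
Proof.
rewrite -flow_root -(@flow_level root) ?depth_root //.
by apply: eq_bigl => v; rewrite anc_root.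
Qed.

End Flow.

(** * The second moment method *)

(** In the variable [1 / x], a term of a Riemann sum for the integral of
    [t `^ (- g)] is at most the integral over its interval. *)
Lemma powR_increment (R : realType) (g x y : R) : 1 < g -> 0 < x -> x <= y ->
  (x^-1 - y^-1) * x `^ g <= (y `^ (g - 1) - x `^ (g - 1)) / (g - 1).
Proof.
move=> g1 x0 xy; have y0 : 0 < y := lt_le_trans x0 xy.
have a0 : 0 < g - 1 by rewrite subr_gt0.
have xg : x `^ g = x * x `^ (g - 1).
  by rewrite -{2}[x]powRr1 ?(ltW x0) // -powRD ?(gt_eqF x0) ?implybT // addrC subrK.
have xa0 : 0 < x `^ (g - 1) by rewrite powR_gt0.
have key : (g - 1) * (1 - x / y) + 1 <= y `^ (g - 1) / x `^ (g - 1).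
  have -> : y `^ (g - 1) / x `^ (g - 1) = expR ((g - 1) * (ln y - ln x)).
    by rewrite /powR (gt_eqF x0) (gt_eqF y0) -expRN -expRD mulrBr.
  apply: le_trans (expR_ge1Dx _); rewrite addrC lerD2l ler_pM2l //.
  have : ln (1 + (x / y - 1)) <= x / y - 1.
    by apply: le_ln1Dx; rewrite ltrBrDl subrr divr_gt0.
  by rewrite addrC subrK lnM ?posrE ?invr_gt0 // lnV ?posrE //; lra.
rewrite ler_pdivlMr // xg.
have -> : (x^-1 - y^-1) * (x * x `^ (g - 1)) * (g - 1) =
  ((g - 1) * (1 - x / y)) * x `^ (g - 1) by field; rewrite !gt_eqF.
rewrite -lerBrDr in key.
apply: le_trans (ler_wpM2r (ltW xa0) key) _.
by rewrite [leLHS]mulrBl mul1r divfK // gt_eqF.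
Qed.

Section SecondMoment.
Variables (R : realType) (T : rootedTree) (T_lf : locally_finite_tree T).
Variables (lambda : R) (m : T -> nat).
Hypothesis lambda_gt0 : 0 < lambda.
Hypothesis m_root : m troot = 0%N.
Hypothesis T_infinite : infinite_set [set: T].
Implicit Types (x y u v w b : T) (h : seq T).
Local Notation root := (@troot T).
Local Notation children := (children T_lf).
Local Notation dug := (dug m).
Local Notation expect := (expect T_lf lambda m).
Local Notation returned := (returned m).
Local Notation stopped := (stopped m).
Local Notation level := (level T_lf).
Local Notation Psi := (Psi lambda m).

Lemma Psi_le_par u : u != root -> Psi u <= Psi (par u).
Proof.
move=> ur; rewrite Psi_par // ger_pMl ?Psi_gt0 //.
by case/andP: (ratio_le1 lambda_gt0 u) => r0 r1; rewrite exprn_ile1.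
Qed.

Lemma Psi_root : Psi root = 1.
Proof. by rewrite /Psi line_root big_nil. Qed.

Lemma Psi_level1 u : depth u = 1%N -> Psi u = 1.
Proof.
move=> u1; have ur : u != root by rewrite -depth_gt0 u1.
have pr : par u = root by apply/eqP; rewrite -depth_eq0; have := depth_par ur; rewrite u1 => -[<-].
by rewrite Psi_par // pr Psi_root /debt0 u1 expr0 mulr1.
Qed.

Lemma Psi_inv_telescope b v : anc b v ->
  (Psi b)^-1 = 1 + \sum_(u <- line v | anc u b) ((Psi u)^-1 - (Psi (par u))^-1).
Proof.
move=> bv; rewrite -big_filter (perm_big (line b)) /=.
  elim/par_ind: (b) => [|u ur IH]; first by rewrite line_root big_nil Psi_root invr1 addr0.
  by rewrite lineE // big_cons addrCA -IH; ring.
apply: uniq_perm; rewrite ?filter_uniq ?uniq_line // => u.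
rewrite mem_filter !mem_line andbCA; congr (_ && _).
by case ub: (anc u b) => //=; apply: anc_trans bv.
Qed.

Variables (g : R) (M : nat).
Hypothesis g_gt1 : 1 < g.
Hypothesis m_le : forall u, (m u <= M)%N.

Definition Psi_pow u : R := Psi u `^ g.

Lemma Psi_pow_ge0 u : 0 <= Psi_pow u.
Proof. exact: powR_ge0. Qed.

(** The intervals are adjacent and start at 1, so that the bound does not depend
    on the length of the line. *)
Lemma energy_line v :
  \sum_(u <- line v) ((Psi u)^-1 - (Psi (par u))^-1) * Psi_pow u <= (g - 1)^-1.
Proof.
have a0 : 0 < g - 1 by rewrite subr_gt0.
apply: (@le_trans _ _ ((1 - Psi v `^ (g - 1)) / (g - 1))); last first.
  by rewrite ler_pdivrMr // mulVf ?gt_eqF // gerBl powR_ge0.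
elim/par_ind: v => [|v vr IH].
  by rewrite line_root big_nil Psi_root powR1 subrr mul0r.
rewrite lineE // big_cons.
have := powR_increment g_gt1 (Psi_gt0 m lambda_gt0 v) (Psi_le_par vr).
rewrite -/(Psi_pow v) => H; apply: le_trans (lerD H IH) _.
by rewrite -mulrDl ler_pM2r ?invr_gt0 //; lra.
Qed.

Section Level.
Variable N : nat.
Hypothesis N_gt0 : (0 < N)%N.
Local Notation flow := (flow T_lf Psi_pow N).
Local Notation supply := (supply T_lf Psi_pow N).
Local Notation deg := ((size (children root))%:R : R).

Lemma flow_le_Psi u : u != root -> (depth u <= N)%N -> flow u <= Psi_pow u.
Proof.
move=> ur uN; apply: le_trans (flow_le_room _ Psi_pow_ge0 ur uN) _; exact: room_le.
Qed.

Lemma supply_le : supply <= deg.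
Proof.
have -> : deg = \sum_(y <- children root) (1 : R).
  by rewrite big_const_seq count_predT iter_addr_0.
have -> : supply = \sum_(y <- children root) room T_lf Psi_pow N y by [].
rewrite big_seq [leRHS]big_seq; apply: ler_sum => y yr.
apply: le_trans (room_le _ _ _ _) _.
by rewrite /Psi_pow Psi_level1 ?powR1 // (child_depth yr) depth_root.
Qed.

(** Expanding [(Psi (b v'))^-1] along the line of [v] groups the vertices [v'] by
    their common ancestors with [v], and the flow through an ancestor [u] is at
    most [Psi u `^ g]. *)
Lemma energy_le (b : T -> T) v : depth v = N ->
  (forall v', forall u, anc u (b v') = anc u v && anc u v') ->
  \sum_(v' <- level N) flow v' / Psi (b v') <= deg + (g - 1)^-1.
Proof.
move=> vN bP.
have bv v' : anc (b v') v by move: (anc_refl (b v')); rewrite bP => /andP[].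
have -> : \sum_(v' <- level N) flow v' / Psi (b v') =
    supply + \sum_(u <- line v) ((Psi u)^-1 - (Psi (par u))^-1) * flow u.
  transitivity (\sum_(v' <- level N) (flow v' +
      \sum_(u <- line v) (if anc u v' then ((Psi u)^-1 - (Psi (par u))^-1) * flow v' else 0))).
    apply: eq_bigr => v' _; rewrite (Psi_inv_telescope (bv v')) mulrDr mulr1; congr (_ + _).
    rewrite mulr_sumr big_mkcond big_seq [RHS]big_seq; apply: eq_bigr => u.
    by rewrite mem_line => /andP[_ uv]; rewrite bP uv /=; case: ifP => // _; rewrite mulrC.
  rewrite big_split /= (flow_total T_lf Psi_pow_ge0) exchange_big /=; congr (_ + _).
  rewrite big_seq [RHS]big_seq; apply: eq_bigr => u; rewrite mem_line => /andP[_ uv].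
  rewrite -big_mkcond -mulr_sumr (flow_level T_lf Psi_pow_ge0) //.
  by rewrite -vN anc_depth.
apply: lerD; first exact: supply_le.
apply: le_trans (energy_line v); rewrite big_seq [leRHS]big_seq; apply: ler_sum => u.
rewrite mem_line => /andP[ur uv]; rewrite ler_wpM2l //; last first.
  by rewrite flow_le_Psi // -vN anc_depth.
by rewrite subr_ge0 lef_pV2 ?posrE ?Psi_gt0 // Psi_le_par.
Qed.

(* Each vertex is weighted by the flow it receives, relative to the order of the
   probability that it is dug. *)
Let coef v : R := flow v / Psi v.
Let Z h : R := \sum_(v <- level N) coef v * (dug (stopped h) v)%:R.

Lemma coef_ge0 v : 0 <= coef v.
Proof. by rewrite divr_ge0 ?(flow_ge0 T_lf Psi_pow_ge0) // ltW // Psi_gt0. Qed.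

Lemma level_neq_root v : v \in level N -> v != root.
Proof. by rewrite mem_level -depth_gt0 => /eqP ->; exact: N_gt0. Qed.

Lemma expect_Z n : deg^-1 ^+ M.+1 * supply -
    (\sum_(v <- level N) coef v) * expect n (fun h => (~~ returned h)%:R)
  <= expect n Z.
Proof.
rewrite /Z expect_sum // -(flow_total T_lf Psi_pow_ge0 N) mulr_sumr mulr_suml -sumrB.
rewrite big_seq [leRHS]big_seq; apply: ler_sum => v vN.
rewrite expectZ // -lerBrDr opprK -mulrDr.
have vr := level_neq_root vN.
pose w := iter (depth v).-1 par v.
have wv : anc w v by apply/ancP; eexists.
have w1 : depth w = 1%N.
  rewrite depth_iter_par; move: vr; rewrite -depth_gt0.
  by case: (depth v) => // d _; rewrite subSnn.
have H := expect_dug_ge T_lf lambda_gt0 m_root T_infinite wv w1 n.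
apply: le_trans (ler_wpM2l (coef_ge0 v) H).
have P0 := Psi_gt0 m lambda_gt0 v.
have -> : coef v * (deg^-1 ^+ (m w).+1 * Psi v) = deg^-1 ^+ (m w).+1 * flow v.
  by rewrite /coef; field; rewrite gt_eqF.
rewrite ler_wpM2r ?(flow_ge0 T_lf Psi_pow_ge0) // ler_wiXn2l ?invr_ge0 //.
  by rewrite invf_le1 ?ltr0n ?ler1n ?(size_children_root T_lf T_infinite).
by rewrite ltnS.
Qed.

Lemma expect_Z2 n :
  expect n (fun h => Z h ^+ 2) <= 4 ^+ M.+1 * (deg * (deg + (g - 1)^-1)).
Proof.
pose b v v' := projT1 (cid (exists_meet v v')).
have bP v v' u : anc u (b v v') = anc u v && anc u v' by rewrite /b; case: cid.
have -> : expect n (fun h => Z h ^+ 2) = \sum_(v <- level N) \sum_(v' <- level N)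
   coef v * coef v' * expect n (fun h => (dug (stopped h) v && dug (stopped h) v')%:R).
  transitivity (expect n (fun h => \sum_(v <- level N) \sum_(v' <- level N)
   coef v * coef v' * (dug (stopped h) v && dug (stopped h) v')%:R)).
    apply: (expect_eq lambda_gt0 m_root) => h _ _.
    rewrite expr2 /Z mulr_suml; apply: eq_bigr => v _.
    rewrite mulr_sumr; apply: eq_bigr => v' _.
    by rewrite mulrACA -natrM mulnb.
  rewrite expect_sum //; apply: eq_bigr => v _.
  rewrite expect_sum //; apply: eq_bigr => v' _; exact: expectZ.
apply: (@le_trans _ _ (\sum_(v <- level N) 4 ^+ M.+1 * (flow v *
   \sum_(v' <- level N) flow v' / Psi (b v v')))).
  rewrite big_seq [leRHS]big_seq; apply: ler_sum => v vN.
  rewrite mulrA mulr_sumr big_seq [leRHS]big_seq; apply: ler_sum => v' v'N.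
  have H := expect_two_dug_le T_lf lambda_gt0 m_root T_infinite n m_le (bP v v')
    (level_neq_root vN) (level_neq_root v'N).
  have c0 : 0 <= coef v * coef v' by rewrite mulr_ge0 ?coef_ge0.
  apply: le_trans (ler_wpM2l c0 H) _; rewrite le_eqVlt; apply/orP; left; apply/eqP.
  have P0 := Psi_gt0 m lambda_gt0.
  by rewrite /coef; field; rewrite !gt_eqF.
rewrite -mulr_sumr ler_wpM2l ?exprn_ge0 //.
apply: (@le_trans _ _ (\sum_(v <- level N) flow v * (deg + (g - 1)^-1))).
  rewrite big_seq [leRHS]big_seq; apply: ler_sum => v; rewrite mem_level => /eqP vN.
  rewrite ler_wpM2l ?(flow_ge0 T_lf Psi_pow_ge0) //.
  exact: (energy_le vN (fun v' u => bP v v' u)).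
rewrite -mulr_suml (flow_total T_lf Psi_pow_ge0) ler_wpM2r ?supply_le //.
by rewrite addr_ge0 // invr_ge0 subr_ge0 ltW.
Qed.

(** [Z] vanishes unless a vertex of level [N] is dug, and
    [2 * t * Z - (t * Z) ^+ 2] is at most one in any case. *)
Lemma expect_has_dug n (t : R) :
  2 * t * expect n Z - t ^+ 2 * expect n (fun h => Z h ^+ 2) <=
  expect n (fun h => (has (dug (stopped h)) (level N))%:R).
Proof.
rewrite -mulNr -!expectZ // -expectD //.
apply: (expect_le lambda_gt0 m_root) => h _ _.
case: (boolP (has _ _)) => [_|/hasPn nd].
  rewrite mulNr -exprMn -subr_ge0.
  have -> : 1 - (2 * t * Z h - (t * Z h) ^+ 2) = (1 - t * Z h) ^+ 2 by ring.
  exact: sqr_ge0.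
have -> : Z h = 0 by rewrite /Z big1_seq // => v /andP[_ /nd/negPf ->]; rewrite mulr0.
by rewrite mulr0 expr0n mulr0 addr0.
Qed.

End Level.

(** With [a] a lower bound for the first moment and [B] an upper bound for the
    second one, the choice [t = a / B] in [expect_has_dug] gives [a ^+ 2 / B]. *)
Lemma dig_deep (c : R) : 0 < c ->
  (forall N, (0 < N)%N -> c <= supply T_lf Psi_pow N) ->
  exists2 c1 : R, 0 < c1 & forall N, (0 < N)%N -> exists2 eps : R, 0 < eps &
    forall n, expect n (fun h => (~~ returned h)%:R) <= eps ->
      c1 <= expect n (fun h => (has (dug (stopped h)) (level N))%:R).
Proof.
move=> c0 cs; pose deg : R := (size (children root))%:R.
have deg0 : 0 < deg by rewrite ltr0n (size_children_root T_lf T_infinite).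
have gi : 0 < (g - 1)^-1 by rewrite invr_gt0 subr_gt0.
pose B : R := 4 ^+ M.+1 * (deg * (deg + (g - 1)^-1)).
have B0 : 0 < B by rewrite mulr_gt0 ?exprn_gt0 // mulr_gt0 // addr_gt0.
pose a : R := deg^-1 ^+ M.+1 * c / 2.
have a0 : 0 < a by rewrite divr_gt0 // mulr_gt0 // exprn_gt0 // invr_gt0.
exists (a ^+ 2 / B); first by rewrite divr_gt0 // exprn_gt0.
move=> N N0; pose K : R := \sum_(v <- level N) flow T_lf Psi_pow N v / Psi v.
have K0 : 0 <= K by apply: sumr_ge0 => v _; exact: coef_ge0.
have K1 : 0 < K + 1 by rewrite ltr_wpDl.
exists (a / (K + 1)); first by rewrite divr_gt0.
move=> n q; apply: le_trans (expect_has_dug N n (a / B)).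
have eZ := expect_Z N0 n; have eZ2 := expect_Z2 N0 n; rewrite -/deg -/B -/K in eZ eZ2.
set EZ := (X in _ <= X) in eZ; set EZ2 := (X in X <= _) in eZ2.
rewrite -/EZ -/EZ2.
have aZ : a <= EZ.
  apply: le_trans eZ.
  have h1 : 2 * a <= deg^-1 ^+ M.+1 * supply T_lf Psi_pow N.
    by rewrite /a mulrC divfK // ler_pM2l ?cs // exprn_gt0 // invr_gt0.
  have h2 : K * expect n (fun h => (~~ returned h)%:R) <= a.
    apply: le_trans (ler_wpM2l K0 q) _.
    by rewrite mulrCA ger_pMr // ler_pdivrMr // mul1r lerDl.
  lra.
have t0 : 0 < a / B by rewrite divr_gt0.
have h1 : 2 * (a / B) * a <= 2 * (a / B) * EZ by rewrite ler_pM2l // mulr_gt0.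
have h2 : (a / B) ^+ 2 * EZ2 <= (a / B) ^+ 2 * B by rewrite ler_pM2l // exprn_gt0.
have h3 : (a / B) ^+ 2 * B = a ^+ 2 / B by field; rewrite gt_eqF.
have h4 : 2 * (a / B) * a = 2 * (a ^+ 2 / B) by field; rewrite gt_eqF.
lra.
Qed.

End SecondMoment.

(** * The transition probabilities *)

Section Law.
Variables (R : realType) (T : rootedTree) (T_lf : locally_finite_tree T).
Variables (lambda : R) (m : T -> nat).
Hypothesis lambda_gt0 : 0 < lambda.
Hypothesis m_root : m troot = 0%N.
Hypothesis T_infinite : infinite_set [set: T].
Implicit Types (y u v : T) (h : seq T) (x : nat -> T).
Local Notation root := (@troot T).
Local Notation children := (children T_lf).
Local Notation neighbors := (neighbors T_lf).
Local Notation dug := (dug m).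
Local Notation valid := (valid T_lf m).
Local Notation prob := (prob T_lf lambda m).
Local Notation expect := (expect T_lf lambda m).

Fixpoint trace x n : seq T := x n :: (if n is n'.+1 then trace x n' else [::]).

Lemma pos_trace x n : pos (trace x n) = x n.
Proof. by case: n. Qed.

Lemma eq_trace x x' n : (forall k, (k <= n)%N -> x k = x' k) -> trace x n = trace x' n.
Proof.
elim: n => [|n IH] e /=; first by rewrite e.
by rewrite e // IH // => k kn; apply: e; rewrite leqW.
Qed.

Lemma trace_nth h n : size h = n.+1 -> trace (fun i => nth root h (n - i)) n = h.
Proof.
elim: n h => [|n IH] [|y h] //= [sh]; first by rewrite (size0nil sh).
rewrite subnn /=; congr (_ :: _); rewrite -[RHS](IH h) //.
by apply: eq_trace => k kn; rewrite subSn.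
Qed.

Lemma trace_inj x x' n : trace x n = trace x' n -> forall k, (k <= n)%N -> x k = x' k.
Proof.
elim: n => [|n IH] /= [e]; first by move=> [|].
by move=> /IH e' k; rewrite leq_eqVlt => /orP[/eqP ->//|]; exact: e'.
Qed.

Lemma local_time_trace x n v : local_time x n v = count_mem v (trace x n).
Proof.
rewrite /local_time -sum1_card.
have -> : count_mem v (trace x n) = (\sum_(k < n.+1) (x k == v))%N.
  elim: n => [|n IH] /=; first by rewrite big_ord_recl big_ord0.
  by rewrite IH [RHS]big_ord_recr addnC.
rewrite big_mkcond; apply: eq_bigr => k _.
have -> : (k \in [set k : 'I_n.+1 | x k == v]) = (x k == v).
  by apply/idP/idP => [/set_mem|/mem_set].
by case: eqP.
Qed.

Lemma edge_of_child u y : y \in children u -> edge_of u y = (u, y).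
Proof. by move=> yx; rewrite /edge_of (child_depth yx) leqnn. Qed.

Lemma edge_of_par y : y != root -> edge_of y (par y) = (par y, y).
Proof. by move=> yr; rewrite /edge_of {1}(depth_par yr) ltnNge leqnSn. Qed.

Lemma weight_child x n y : y \in children (x n) ->
  weight lambda m x n (edge_of (x n) y) =
  (dug (trace x n) (x n))%:R * lambda ^- depth (x n).
Proof.
move=> yc; rewrite edge_of_child // /weight /elevel /= local_time_trace (child_depth yc) /=.
by rewrite /dug ltnNge; case: (_ <= _)%N; rewrite ?subrr ?subr0.
Qed.

Lemma weight_par x n : valid (trace x n) -> x n != root ->
  weight lambda m x n (edge_of (x n) (par (x n))) = lambda ^- (depth (x n)).-1.
Proof.
move=> vh xr; rewrite edge_of_par // /weight /elevel /= local_time_trace.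
have := valid_dug_par vh (pos_mem vh); rewrite pos_trace => /(_ xr).
by rewrite /dug ltnNge => /negPf ->; rewrite subr0 mul1r.
Qed.

(** All positive weights at a vertex are multiples of [lambda ^- depth (x n)],
    which cancels. *)
Lemma weight_ratio x n y : valid (trace x n) -> adj (x n) y ->
  weight lambda m x n (edge_of (x n) y) /
    \sum_(y' \in [set y' | adj (x n) y']) weight lambda m x n (edge_of (x n) y') =
  prob (trace x n) y.
Proof.
move=> vh ay.
have -> : [set y' | adj (x n) y'] = [set` neighbors (x n)].
  by apply/seteqP; split => z /=; rewrite mem_neighbors.
rewrite -fsbig_seq ?uniq_neighbors // /prob pos_trace.
have sumch : \sum_(y' <- children (x n)) weight lambda m x n (edge_of (x n) y') =
    (size (children (x n)))%:R * ((dug (trace x n) (x n))%:R * lambda ^- depth (x n)).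
  rewrite mulr_natl -iter_addr_0 -(count_predT (children _)) -big_const_seq.
  by rewrite big_seq [RHS]big_seq; apply: eq_bigr => z zc; rewrite weight_child.
have l0 : lambda != 0 by rewrite gt_eqF.
have [xr|xr] := eqVneq (x n) root.
  have dx : dug (trace x n) (x n) by rewrite xr dug_root.
  have pnb : perm_eq (neighbors (x n)) (children (x n)) by rewrite xr perm_neighbors_root.
  have yc : y \in children (x n) by rewrite -(perm_mem pnb) mem_neighbors.
  rewrite (perm_big _ pnb) /= sumch weight_child // dx xr depth_root /=.
  by rewrite expr0 invr1 !mulr1 div1r.
rewrite (perm_big _ (perm_neighbors T_lf xr)) big_cons sumch weight_par //.
have e1 : lambda ^- (depth (x n)).-1 = lambda * lambda ^- depth (x n).
  by rewrite (depth_par xr) /= exprS invfM mulrA divff // mul1r.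
have ld : lambda ^- depth (x n) != 0 by rewrite invr_neq0 // expf_neq0.
have dn := lt0r_neq0 (den_gt0 T_lf lambda_gt0 (x n)).
have wy : weight lambda m x n (edge_of (x n) y) =
    (if y == par (x n) then lambda else (dug (trace x n) (x n))%:R) * lambda ^- depth (x n).
  case/adjP: ay => -[yr e]; last by rewrite e eqxx weight_par // e1.
  have yc : y \in children (x n) by rewrite mem_children yr e eqxx.
  have /negPf -> : y != par (x n).
    by apply: contraTneq yc => ->; exact: par_notin_children.
  exact: weight_child.
rewrite wy e1; move: (lambda ^- depth (x n)) ld => L L0.
case: (dug (trace x n) (x n)) => /=.
  by rewrite mul1r -mulrDl; case: ifP => _; field; rewrite dn L0.
rewrite mul0r mulr0 addr0; case: ifP => _; last by rewrite !mul0r.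
by rewrite divff // mulf_neq0.
Qed.

Fixpoint histories n : seq (seq T) :=
  if n is n'.+1 then [seq y :: h | h <- histories n', y <- neighbors (pos h)]
  else [:: [:: root]].

Lemma expect_support n (f g : seq T -> R) :
  (forall h, h \in histories n -> f h = g h) -> expect n f = expect n g.
Proof.
elim: n f g => [|n IH] f g fg /=; first by apply: fg; rewrite inE.
apply: IH => h hn; apply: eq_big_seq => y yn.
by rewrite fg //; apply/allpairsPdep; exists h, y.
Qed.

End Law.

(** * The law of the walk *)

Section Coupling.
Variables (R : realType) (T : rootedTree) (T_lf : locally_finite_tree T).
Variables (lambda : R) (m : T -> nat).
Hypothesis lambda_gt0 : 0 < lambda.
Hypothesis m_root : m troot = 0%N.
Hypothesis T_infinite : infinite_set [set: T].
Variables (d : measure_display) (Omega : measurableType d) (P : probability Omega R).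
Variable X : nat -> Omega -> T.
Hypothesis X_DRW : digging_random_walk lambda m P X.
Implicit Types (y u v : T) (h : seq T) (x : nat -> T).
Local Notation root := (@troot T).
Local Notation neighbors := (neighbors T_lf).
Local Notation valid := (valid T_lf m).
Local Notation prob := (prob T_lf lambda m).
Local Notation expect := (expect T_lf lambda m).
Local Notation histories := (histories T_lf).

Definition past n (w : Omega) : seq T := trace (fun i => X i w) n.

Lemma past_cons n w : past n.+1 w = X n.+1 w :: past n w.
Proof. by []. Qed.

Lemma measurable_X n v : measurable [set w | X n w = v].
Proof. by case: X_DRW => mX _ _; exact: mX. Qed.

Lemma measurable_past n h : measurable [set w | past n w = h].
Proof.
elim: n h => [|n IH] h.
  case: h => [|y [|z h]].
  - by rewrite (_ : [set _ | _] = set0) //; apply/seteqP; split.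
  - rewrite (_ : [set _ | _] = [set w | X 0%N w = y]); first exact: measurable_X.
    by apply/seteqP; split => w /=; [case|move=> <-].
  - by rewrite (_ : [set _ | _] = set0) //; apply/seteqP; split.
case: h => [|y h].
  by rewrite (_ : [set _ | _] = set0) //; apply/seteqP; split.
rewrite (_ : [set _ | _] = [set w | X n.+1 w = y] `&` [set w | past n w = h]).
  by apply: measurableI; [exact: measurable_X|exact: IH].
by apply/seteqP; split => w /=; rewrite past_cons; [case|case=> -> ->].
Qed.

(** The tree is countable, so that the event is a countable union of events that
    fix the past. *)
Lemma measurable_past_event n (Q : set (seq T)) :
  measurable [set w | Q (past n w)].
Proof.
have /countable_injP[f finj] := countable_tree T_lf.
pose code (h : seq T) : nat := pickle (map f h).
have code_inj : injective code.
  move=> h h' /(pcan_inj pickleK) /inj_map; apply=> u v fe.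
  by apply: finj; rewrite ?inE.
have -> : [set w | Q (past n w)] =
    \bigcup_k [set w | Q (past n w) /\ code (past n w) = k].
  by apply/seteqP; split => w /=; [move=> Qw; exists (code (past n w))|case=> k _ []].
apply: bigcupT_measurable => k.
have [[h hk]|nh] := pselect (exists h, code h = k); last first.
  rewrite (_ : [set _ | _] = set0) //; apply/seteqP; split => // w /= [_ e].
  by apply: nh; exists (past n w).
have [Qh|nQ] := pselect (Q h).
  rewrite (_ : [set _ | _] = [set w | past n w = h]); first exact: measurable_past.
  apply/seteqP; split => w /=; first by case=> _; rewrite -hk => /code_inj.
  by move=> ->.
rewrite (_ : [set _ | _] = set0) //; apply/seteqP; split => // w /= [Qw].
by rewrite -hk => /code_inj e; apply: nQ; rewrite -e.
Qed.

Lemma past_history n x : [set w | past n w = trace x n] = history X n x.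
Proof.
apply/seteqP; split => w /= e.
  by move=> k kn; apply: (trace_inj e).
by apply: eq_trace => k kn; apply: e.
Qed.

Let p (A : set Omega) : R := fine (P A).

Lemma pE (A : set Omega) : measurable A -> P A = (p A)%:E.
Proof. by move=> mA; rewrite /p fineK // fin_num_measure. Qed.

Lemma p_ge0 (A : set Omega) : 0 <= p A.
Proof. by rewrite fine_ge0. Qed.

Lemma p_le (A B : set Omega) : measurable A -> measurable B -> A `<=` B -> p A <= p B.
Proof.
by move=> mA mB AB; rewrite -lee_fin -!pE // le_measure ?inE.
Qed.

Lemma pU (A B : set Omega) : measurable A -> measurable B -> A `&` B = set0 ->
  p (A `|` B) = p A + p B.
Proof.
move=> mA mB AB; apply: EFin_inj; rewrite EFinD -!pE //; last exact: measurableU.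
by rewrite measureU.
Qed.

Lemma p_setT : p setT = 1.
Proof. by rewrite /p probability_setT. Qed.

Lemma p_past_in n (s : seq (seq T)) : uniq s ->
  p [set w | past n w \in s] = \sum_(h <- s) p [set w | past n w = h].
Proof.
elim: s => [|h s IH] /=.
  move=> _; rewrite big_nil (_ : [set _ | _] = set0) ?/p ?measure0 //.
  by apply/seteqP; split.
move=> /andP[hs us]; rewrite big_cons -IH //.
rewrite -pU; [|exact: measurable_past|exact: (measurable_past_event n [set h | h \in s])|].
  congr p; apply/seteqP; split => w /=; rewrite inE.
    by move=> /orP[/eqP|]; [left|right].
  by case=> [->|->]; rewrite ?eqxx ?orbT.
apply/seteqP; split => // w /= [-> ]; by rewrite (negPf hs).
Qed.

Lemma p_past_cons_le n h (s : seq T) : uniq s ->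
  \sum_(y <- s) p [set w | past n.+1 w = y :: h] <= p [set w | past n w = h].
Proof.
move=> us; have -> : \sum_(y <- s) p [set w | past n.+1 w = y :: h] =
    \sum_(k <- [seq y :: h | y <- s]) p [set w | past n.+1 w = k].
  by rewrite big_map.
rewrite -p_past_in; last by rewrite map_inj_uniq // => y z [].
apply: p_le; [exact: (measurable_past_event n.+1 [set k | k \in _])|exact: measurable_past|].
by move=> w /= /mapP[y _]; rewrite past_cons => -[].
Qed.

(** The conditional probabilities are only given for steps along edges; as they
    add up to one, other steps have probability zero. *)
Lemma p_past n h : p [set w | past n w = h] = expect n (fun k => (k == h)%:R).
Proof.
elim: n h => [|n IH] h.
  rewrite /=; have [<-|nh] := eqVneq [:: root] h.
    rewrite /p (_ : [set _ | _] = [set w | X 0%N w = root]).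
      by case: X_DRW => _ -> _.
    by apply/seteqP; split => w /=; [case|rewrite /past /= => ->].
  rewrite [RHS](_ : _ = 0) //; apply/eqP; rewrite eq_le p_ge0 andbT.
  have mroot := measurable_X 0%N root.
  have <- : p (~` [set w | X 0%N w = root]) = 0.
    have := pU mroot (measurableC mroot) (setICr _).
    rewrite setUCr p_setT; have -> : p [set w | X 0%N w = root] = 1.
      by rewrite /p; case: X_DRW => _ -> _.
    by lra.
  apply: p_le; [exact: measurable_past|exact: measurableC|].
  by move=> w /= ph e; move: nh; rewrite -ph /past /= e eqxx.
case: h => [|y h].
  rewrite (_ : [set _ | _] = set0) /=; last by apply/seteqP; split.
  rewrite /p measure0 /=; rewrite -[LHS](expect_cst T_lf lambda_gt0 m_root T_infinite n 0).
  apply: (expect_eq lambda_gt0 m_root) => k vk _.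
  by rewrite -[LHS](step_cst lambda_gt0 m_root T_infinite _ vk); apply: (step_eq lambda_gt0 m_root vk).
have e1 : expect n.+1 (fun k => (k == y :: h)%:R) =
    (if y \in neighbors (pos h) then prob h y else 0) * p [set w | past n w = h].
  rewrite IH -expectZ //=; apply: (expect_eq lambda_gt0 m_root) => k vk _.
  have [->|kh] := eqVneq k h; last first.
    rewrite mulr0 -[RHS](step_cst lambda_gt0 m_root T_infinite _ vk).
    apply: (step_eq lambda_gt0 m_root vk) => z _.
    by rewrite eqseq_cons (negPf kh) andbF.
  rewrite mulr1; case: ifP => yn.
    transitivity (\sum_(z <- neighbors (pos h)) if z == y then prob h z else 0).
      by apply: eq_bigr => z _; rewrite eqseq_cons eqxx andbT; case: (z == y); rewrite ?mulr1 ?mulr0.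
    by rewrite -big_mkcond -big_filter filter_pred1_uniq ?uniq_neighbors // big_seq1.
  rewrite [RHS](_ : _ = \sum_(z <- neighbors (pos h)) (0 : R)); last by rewrite big1.
  apply: eq_big_seq => z zn; rewrite eqseq_cons eqxx andbT.
  by case: eqP => [e|]; rewrite ?mulr0 //; move: yn; rewrite -e zn.
rewrite e1.
have sub : p [set w | past n.+1 w = y :: h] <= p [set w | past n w = h].
  apply: p_le; [exact: measurable_past|exact: measurable_past|].
  by move=> w; rewrite /= past_cons => -[].
have [p0|pn0] := eqVneq (p [set w | past n w = h]) 0.
  by rewrite p0 mulr0; apply/eqP; rewrite eq_le p_ge0 andbT -p0.
have vh : valid h && (size h == n.+1).
  apply: contraNT pn0 => nv; rewrite IH -[X in _ == X](expect_cst T_lf lambda_gt0 m_root T_infinite n 0).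
  apply/eqP; apply: (expect_eq lambda_gt0 m_root) => k vk sk.
  by case: eqP => // e; move: nv; rewrite -e vk sk eqxx.
case/andP: vh => vh /eqP sh.
pose x i := nth root h (n - i).
have xh : trace x n = h by exact: trace_nth.
have xn : x n = pos h by rewrite -xh pos_trace.
have stepP z : adj (pos h) z ->
    p [set w | past n.+1 w = z :: h] = prob h z * p [set w | past n w = h].
  move=> az; case: X_DRW => _ _ /(_ n x z); rewrite -past_history xh xn.
  rewrite pE ?lte_fin ?lt_neqAle ?p_ge0 1?eq_sym ?pn0; last exact: measurable_past.
  move=> /(_ isT az); rewrite -xn weight_ratio // ?xh // ?xn // => <-.
  rewrite /cond_prob -!/(p _) divfK //; congr p.
  by apply/seteqP; split => w /=; rewrite past_cons; [case|case=> -> ->].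
case: ifP => yn; first by apply: stepP; rewrite -(mem_neighbors T_lf).
rewrite mul0r; apply/eqP; rewrite eq_le p_ge0 andbT.
have := @p_past_cons_le n h (y :: neighbors (pos h)); rewrite /= yn uniq_neighbors => /(_ isT).
rewrite big_cons.
have -> : \sum_(z <- neighbors (pos h)) p [set w | past n.+1 w = z :: h] = p [set w | past n w = h].
  rewrite -[RHS](step_cst lambda_gt0 m_root T_infinite _ vh).
  by apply: eq_big_seq => z; rewrite mem_neighbors => /stepP.
by rewrite gerDr.
Qed.

Lemma expect_histories n (f : seq T -> R) :
  expect n f = \sum_(h <- undup (histories n)) f h * p [set w | past n w = h].
Proof.
under eq_bigr => h _ do rewrite p_past -expectZ //.
rewrite -expect_sum //; apply: expect_support => k kn.
rewrite (bigD1_seq k) ?mem_undup ?undup_uniq //= eqxx mulr1 big1 ?addr0 // => h.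
by rewrite eq_sym => /negPf ->; rewrite mulr0.
Qed.

(** Summing over the finitely many possible pasts bounds the probabilities of
    [Q] and of its complement from below, and these bounds add up to one. *)
Lemma p_past_event n (Q : pred (seq T)) :
  p [set w | Q (past n w)] = expect n (fun h => (Q h)%:R).
Proof.
have ge (B : pred (seq T)) : expect n (fun h => (B h)%:R) <= p [set w | B (past n w)].
  rewrite expect_histories.
  have -> : \sum_(h <- undup (histories n)) (B h)%:R * p [set w | past n w = h] =
      \sum_(h <- [seq h <- undup (histories n) | B h]) p [set w | past n w = h].
    rewrite big_filter [RHS]big_mkcond; apply: eq_bigr => h _.
    by case: (B h); rewrite ?mul1r ?mul0r.
  rewrite -p_past_in ?filter_uniq ?undup_uniq //.
  apply: p_le; [exact: (measurable_past_event n [set k | k \in _])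
               |exact: (measurable_past_event n [set k | B k])|].
  by move=> w /=; rewrite mem_filter => /andP[].
have mQ := measurable_past_event n [set k | Q k].
have := pU mQ (measurableC mQ) (setICr _); rewrite setUCr p_setT.
have -> : p (~` [set w | [set k | Q k] (past n w)]) = p [set w | (predC Q) (past n w)].
  by congr p; apply/seteqP; split => w /=; [move/negP|move=> /negP].
have : expect n (fun h => (Q h)%:R) + expect n (fun h => ((predC Q) h)%:R) = 1.
  rewrite -expectD // -[RHS](expect_cst T_lf lambda_gt0 m_root T_infinite n 1).
  apply: (expect_eq lambda_gt0 m_root) => h _ _.
  by rewrite /=; case: (Q h); rewrite ?addr0 ?add0r.
have := ge Q; have := ge (predC Q).
change (p [set w | [set k | Q k] (past n w)]) with (p [set w | Q (past n w)]).
by lra.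
Qed.

End Coupling.

(** * The return time of the extracted walk *)

Lemma first_time_None (Q : pred nat) : first_time Q = None <-> forall n, ~~ Q n.
Proof.
rewrite /first_time; case: pselect => [h|nh]; split=> //.
  by case: h => n Qn /(_ n); rewrite Qn.
by move=> _ n; apply/negP => Qn; apply: nh; exists n.
Qed.

Lemma first_time_Some (Q : pred nat) k : first_time Q = Some k ->
  Q k /\ forall j, Q j -> (k <= j)%N.
Proof.
by rewrite /first_time; case: pselect => // h [<-]; case: ex_minnP.
Qed.

Section Return.
Variables (T : rootedTree) (m : T -> nat).
Hypothesis m_root : m troot = 0%N.
Implicit Types (y u v : T) (h : seq T) (x : nat -> T).
Local Notation root := (@troot T).

(** On trajectories from the root this is [returned]. The other trajectories have
    probability zero, but are included in the event whose measurability is at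
    stake; for them the starting vertex counts as dug. *)
Fixpoint back h : bool :=
  if h is y :: h' then
    back h' || ((y == root) && (some_dug m h' || (last root h' != root)))
  else false.

Lemma last_trace x n : last root (trace x n) = x 0%N.
Proof. by elim: n => //= n; case: n. Qed.

Lemma dug_trace_first x n u : dug m (trace x n) u ->
  exists i, [/\ (i <= n)%N, x i = u & dug m (trace x i) u].
Proof.
elim: n => [|n IH] du.
  by exists 0%N; split => //; have := dug_mem du; rewrite inE => /eqP.
have [e|ne] := eqVneq u (x n.+1); first by exists n.+1.
have [|i [ni xi di]] := IH; first by move: du; rewrite /= dug_cons_neq.
by exists i; split => //; apply: leqW.
Qed.

Lemma dug_trace_mono x i n u : (i <= n)%N -> dug m (trace x i) u -> dug m (trace x n) u.
Proof.
move=> /subnK <-; elim: (n - i)%N => //= k IH di; exact/dug_cons/IH.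
Qed.

Lemma backP x n : reflect (exists k i, [/\ (k <= n)%N, (i < k)%N, x k = root, x i != root
    & i = 0%N \/ dug m (trace x i) (x i)]) (back (trace x n)).
Proof.
apply: (iffP idP) => [|[k [i [kn ik xk xi di]]]].
  elim: n => [|n IH] /=; first by rewrite eqxx andbF.
  case/orP => [/IH[k [i [kn ik xk xi di]]]|/andP[/eqP xn]].
    by exists k, i; split => //; apply: leqW.
  case/orP => [/some_dugP[u ur /dug_trace_first[i [ni xi di]]]|].
    by exists n.+1, i; split => //; rewrite xi //; right.
  by rewrite last_trace => x0; exists n.+1, 0%N; split => //; left.
have bk : back (trace x k).
  case: k ik {kn} xk => // k ik xk /=; rewrite xk eqxx /= last_trace; apply/orP; right.
  case: di => [i0|di]; first by move: xi; rewrite i0 => ->; rewrite orbT.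
  apply/orP; left; apply/some_dugP; exists (x i) => //; exact: dug_trace_mono di.
by rewrite -(subnK kn); elim: (n - k)%N => //= j ->.
Qed.

Lemma local_time_dug x k : (m (x k) + 1 <= local_time x k (x k))%N = dug m (trace x k) (x k).
Proof. by rewrite local_time_trace addn1. Qed.

Lemma sigmaS x n k : sigma m x n.+1 = Some k -> exists s,
  [/\ sigma m x n = Some s, (s < k)%N, x k != x s & dug m (trace x k) (x k)].
Proof.
move=> /=; case: (sigma m x n) => // s /first_time_Some[/and3P[sk xk lt] _].
by exists s; split => //; rewrite -local_time_dug.
Qed.

Lemma sigmaS_le x n s k : sigma m x n = Some s -> (s < k)%N -> x k != x s ->
  dug m (trace x k) (x k) -> exists2 k', sigma m x n.+1 = Some k' & (s < k' <= k)%N.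
Proof.
move=> /= -> sk xk dk.
pose Q k0 := [&& (s < k0)%N, x k0 != x s & (m (x k0) + 1 <= local_time x k0 (x k0))%N].
rewrite -/Q; have Qk : Q k by rewrite /Q sk xk local_time_dug.
case e : (first_time Q) => [k'|]; last first.
  by move/first_time_None: e => /(_ k); rewrite Qk.
have [Qk' mk] := first_time_Some e; exists k' => //.
by rewrite mk // andbT; case/and3P: Qk'.
Qed.

(** Suppose that the root is visited at time [k], after another vertex was dug. As
    long as the extracted walk is not back at the root, time [k] is a candidate
    for the next extraction time, so that infinitely many of them would precede
    [k] if the extracted walk never returned. *)
Lemma return_time_None x :
  return_time m x = None <-> forall n, ~~ back (trace x n).
Proof.
rewrite /return_time first_time_None; split=> [nr n|back_no k].
  apply/backP => -[k [i [_ ik xk xi di]]].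
  have H n' : exists s, [/\ sigma m x n' = Some s, (n' <= s)%N & (s < k)%N].
    elim: n' => [|n' [s [ss ns sk]]].
      by exists 0%N; split => //; apply: leq_ltn_trans ik.
    have nret j s' : sigma m x j.+1 = Some s' -> x s' != root.
      move=> sj; apply: contraNneq (nr j.+1) => xs'.
      by rewrite /extracted sj xs' eqxx.
    have [xs|xs] := eqVneq (x s) root; last first.
      have [k' sk' /andP[sk1 k1k]] : exists2 k', sigma m x n'.+1 = Some k' & (s < k' <= k)%N.
        apply: sigmaS_le => //; first by rewrite xk eq_sym.
        have rin j : x j = root -> root \in trace x j.
          by case: j => [|j] /= <-; rewrite inE eqxx.
        by rewrite xk /dug m_root -has_count has_pred1 rin.
      exists k'; split=> //; first exact: leq_ltn_trans sk1.
      rewrite ltn_neqAle k1k andbT; apply/eqP => ek.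
      by have := nret _ _ sk'; rewrite ek xk eqxx.
    case: n' ss ns => [[s0] _|n' ss ns]; last by have := nret _ _ ss; rewrite xs eqxx.
    have i0 : i != 0%N by apply: contraNneq xi => ->; rewrite s0 xs.
    have {}di : dug m (trace x i) (x i) by case: di => // /eqP; rewrite (negPf i0).
    have [||k' sk' /andP[sk1 k1i]] := @sigmaS_le x 0 0%N i erefl _ _ di.
    - by rewrite lt0n.
    - by move: xi; rewrite -xs -s0.
    by exists k'; split => //; apply: leq_ltn_trans ik.
  by have [s [_ ks sk]] := H k; move: (leq_ltn_trans ks sk); rewrite ltnn.
apply/negP => /andP[]; case: k => // k _.
rewrite /extracted; case sk : (sigma m x k.+1) => [s|] // /eqP[xs].
have [s' [ss' s's xs' ds]] := sigmaS sk.
have /backP[] := back_no s; exists s, s'; split => //; first by rewrite -xs eq_sym.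
case: k sk ss' => [_ [<-]|k _ /sigmaS[s2 [_ _ _ ds']]]; [by left|by right].
Qed.

Variable T_lf : locally_finite_tree T.

Lemma back_valid h : valid T_lf m h -> back h = returned m h.
Proof.
elim: h => // y [|z h] IH vh; first by rewrite /= eqxx !andbF.
have vh' : valid T_lf m (z :: h) by apply: (@valid_behead _ _ _ y).
rewrite [LHS]/= [RHS]/= -/(back (z :: h)) IH //.
have -> : last z h = root; last by rewrite eqxx orbF.
elim: h z vh' {IH vh} => [|u h IH] z; first by move=> /= /eqP.
by move=> vz; apply: (IH u); apply: (@valid_behead _ _ _ z).
Qed.

End Return.

(** * The branching-ruin number *)

Section RuinNumber.
Variables (R : realType) (T : rootedTree) (T_lf : locally_finite_tree T).
Variables (lambda : R) (m : T -> nat).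
Hypothesis lambda_gt0 : 0 < lambda.
Implicit Types (u v : T) (pi : set (T * T)).
Local Notation root := (@troot T).
Local Notation Psi := (Psi lambda m).

(** Both forms of the weight are quotients of geometric sums. *)
Lemma psiM_ratio u : u != root -> psiM lambda m (par u, u) = ratio lambda u ^+ debt0 m u.
Proof.
move=> ur; rewrite /psiM /elevel /= /debt0; case: ifP => // d1.
have [d dE] : exists d, depth u = d.+2.
  by have := ur; rewrite -depth_gt0; case: (depth u) d1 => [|[|d]] // _ _; exists d.
rewrite /ratio dE; have rd := lt0r_neq0 (resistance_gt0 lambda_gt0 (ltn0Sn d.+1)).
case: ifP => l1; congr (_ ^+ _); rewrite /=.
  have l10 : lambda - 1 != 0 by rewrite subr_eq0.
  by rewrite !subrX1 -!/(resistance lambda _) -mulf_div divff // mul1r.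
move/negbT: l1; rewrite negbK => /eqP l1.
have resn n : resistance lambda n = n%:R.
  rewrite /resistance l1; under eq_bigr do rewrite expr1n.
  by rewrite sumr_const card_ord.
by rewrite !resn.
Qed.

Lemma prod_psiM e : edges e ->
  \big[*%R/1%R]_(g \in [set g | edges g /\ edge_le g e]) psiM lambda m g = Psi e.2.
Proof.
move=> ee.
have -> : [set g | edges g /\ edge_le g e] = [set` [seq (par u, u) | u <- line e.2]].
  apply/seteqP; split => g /=.
    case=> eg ge; have [gr g1] := (edgesP g).1 eg; have gl := (edge_leP e eg).1 ge.
    by apply/mapP; exists g.2 => //; rewrite -g1; case: (g).
  move=> /mapP[u ul ->]; have eg : edges (par u, u).
    by apply/edgesP; split => //=; move: ul; rewrite mem_line => /andP[].
  by split => //; apply/(edge_leP _ eg).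
rewrite -fsbig_seq; last by rewrite map_inj_uniq ?uniq_line // => u v [].
rewrite big_map; apply: eq_big_seq => u.
by rewrite mem_line => /andP[ur _]; rewrite psiM_ratio.
Qed.

Definition cut_sum gamma pi : \bar R :=
  (\esum_(e in pi) (((\big[*%R/1%R]_(g \in [set g | edges g /\ edge_le g e])
      psiM lambda m g) `^ gamma)%:E))%E.

Lemma cut_sumE gamma pi : pi `<=` @edges T ->
  cut_sum gamma pi = (\esum_(e in pi) (Psi e.2 `^ gamma)%:E)%E.
Proof. by move=> pe; apply: eq_esum => e /pe/prod_psiM ->. Qed.

(** The exponent 1 does not belong to the set whose supremum is taken. *)
Lemma RT_lt1 : (RT (psiM lambda m) < 1)%E -> forall eps : R, 0 < eps ->
  exists2 pi, cutset pi & (\esum_(e in pi) (Psi e.2)%:E < eps%:E)%E.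
Proof.
move=> RT1 eps eps0.
have : ~ (0 < ereal_inf [set cut_sum 1 pi | pi in @cutset T])%E.
  move=> pos; move: RT1; apply/negP; rewrite -leNgt; apply: ereal_sup_ubound.
  by right; exists 1 => //; split => //; exact: ltr01.
move/negP; rewrite -leNgt => le0.
have : (ereal_inf [set cut_sum 1 pi | pi in @cutset T] < eps%:E)%E.
  by apply: le_lt_trans le0 _; rewrite lte_fin.
move=> /ereal_inf_lt[_ [pi cpi <-]] lt; exists pi => //.
move: lt; rewrite cut_sumE; last by case: cpi.
by under eq_esum do rewrite powRr1 ?(ltW (Psi_gt0 m lambda_gt0 _)) //.
Qed.

Lemma RT_gt1 : (1 < RT (psiM lambda m))%E -> exists g c : R,
  [/\ 1 < g, 0 < c & forall pi, cutset pi ->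
    (c%:E <= \esum_(e in pi) (Psi e.2 `^ g)%:E)%E].
Proof.
move=> /ereal_sup_gt[y [->|[g [g0 gpos] <-]]]; first by rewrite lte_fin ltr10.
rewrite lte_fin => g1.
have [c c0 cle] : exists2 c : R, 0 < c &
    (c%:E <= ereal_inf [set cut_sum g pi | pi in @cutset T])%E.
  move: gpos; rewrite -/(cut_sum g _); case: (ereal_inf _) => [r|_|//].
    by rewrite lte_fin => r0; exists r.
  by exists 1 => //; rewrite leey.
exists g, c; split => // pi cpi; rewrite -cut_sumE; last by case: cpi.
by apply: (le_trans cle); apply: ereal_inf_lbound; exists pi.
Qed.

Lemma supply_cut g c N : (0 < N)%N ->
  (forall pi, cutset pi -> (c%:E <= \esum_(e in pi) (Psi e.2 `^ g)%:E)%E) ->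
  c <= supply T_lf (Psi_pow lambda m g) N.
Proof.
case: N => // N _ cle; have := cle _ (cutset_rootcut T_lf (Psi_pow lambda m g) N).
rewrite esum_fset; [|exact: finite_seq|by move=> e _; rewrite lee_fin powR_ge0].
rewrite -fsbig_seq; last by rewrite map_inj_uniq ?uniq_rootcut // => u v [].
rewrite big_map /= sumEFin lee_fin => /le_trans; apply.
rewrite le_eqVlt; apply/orP; left; apply/eqP.
rewrite big_flatten big_map; apply: eq_big_seq => y yr.
by rewrite /room (child_depth yr) depth_root subSS subn0 capE.
Qed.

End RuinNumber.

(** * Recurrence and transience *)

Section Dichotomy.
Variables (R : realType) (T : rootedTree) (T_lf : locally_finite_tree T).
Variables (lambda : R) (m : T -> nat).
Hypothesis lambda_gt0 : 0 < lambda.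
Hypothesis m_root : m troot = 0%N.
Hypothesis T_infinite : infinite_set [set: T].
Local Notation root := (@troot T).
Local Notation dug := (dug m).
Local Notation valid := (valid T_lf m).
Local Notation expect := (expect T_lf lambda m).
Local Notation returned := (returned m).
Local Notation stopped := (stopped m).

Lemma expect_drop k n (F : seq T -> R) :
  expect (k + n) (fun h => F (drop k h)) = expect n F.
Proof.
elim: k => [|k IH]; first by apply: (expect_eq lambda_gt0 m_root) => h _ _; rewrite drop0.
rewrite -IH addSn /=; apply: (expect_eq lambda_gt0 m_root) => h vh _.
by rewrite -[RHS](step_cst lambda_gt0 m_root T_infinite _ vh).
Qed.

Lemma valid_depth h u : valid h -> u \in h -> (depth u < size h)%N.
Proof.
elim: h u => // y [|x h] IH u vh.
  by rewrite inE; move: vh => /= /eqP -> /eqP ->; rewrite depth_root.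
have vh' := @valid_behead _ _ _ y (x :: h) isT vh.
rewrite inE => /orP[/eqP ->|/(IH _ vh')]; last exact: leqW.
have dx := IH x vh' (mem_head _ _).
move: vh; rewrite valid_cons // => /andP[_] /=; case: ifP => [yc _|_ /andP[xr /eqP ->]].
  by rewrite (child_depth yc).
by move: dx; rewrite (depth_par xr) /=; exact: leq_trans (leqW _).
Qed.

Lemma returned_drop k h : returned (drop k h) ->
  returned h /\ stopped h = stopped (drop k h).
Proof.
elim: k h => [|k IH] h; first by rewrite drop0.
by case: h => [|y h] //= /IH[rh sh]; rewrite rh sh.
Qed.

Lemma size_stopped h : (size (stopped h) <= size h)%N.
Proof. by elim: h => //= y h IH; case: ifP => // _; exact: leqW. Qed.

Lemma expect_not_returned_antitone k n : (k <= n)%N ->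
  expect n (fun h => (~~ returned h)%:R) <= expect k (fun h => (~~ returned h)%:R).
Proof.
move=> kn; rewrite -(expect_drop (n - k) k) subnK //.
apply: (expect_le lambda_gt0 m_root) => h _ _; rewrite ler_nat.
have [/returned_drop[-> _]//|_] := boolP (returned (drop _ h)).
exact: leq_b1.
Qed.

(** Within [k] steps the walk stays at depth at most [k], so digging a vertex
    at depth [k + 1] before the return forces the return to happen after time
    [k]. *)
Lemma expect_dug_level_le k n : (k <= n)%N ->
  expect n (fun h => (has (dug (stopped h)) (level T_lf k.+1))%:R) <=
  expect k (fun h => (~~ returned h)%:R).
Proof.
move=> kn; rewrite -(expect_drop (n - k) k) subnK //.
apply: (expect_le lambda_gt0 m_root) => h vh sh; rewrite ler_nat.
case: (boolP (returned _)) => [rd|_]; last exact: leq_b1.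
have [rh eq_st] := returned_drop rd.
have /negPf -> // : ~~ has (dug (stopped h)) (level T_lf k.+1).
apply/hasPn => v; rewrite mem_level => /eqP vk; apply/negP => dv.
have := valid_depth (stopped_valid vh) (dug_mem dv).
rewrite vk eq_st => lt; have := leq_trans lt (size_stopped _).
by rewrite size_drop sh; lia.
Qed.

(** First moment argument. By König's lemma all lines of some depth [N] cross
    a cutset of small weight; up to the small probability of being still
    confined above level [N], not having returned forces the walk to have dug
    a vertex of the cutset, and the sum of [Psi] over the cutset bounds the
    probability of that. *)
Lemma expect_not_returned_small : (RT (psiM lambda m) < 1)%E ->
  forall eps, 0 < eps -> exists n, expect n (fun h => (~~ returned h)%:R) <= eps.
Proof.
move=> RT1 eps eps0; have e2 : 0 < eps / 2 by rewrite divr_gt0.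
have Psi0 := Psi_gt0 m lambda_gt0.
have [pi [pie piu] pisum] := RT_lt1 lambda_gt0 RT1 e2.
pose B (u : T) : bool := `[< pi (par u, u) >].
have [N NB] : exists N, forall v : T, depth v = N -> has B (line v).
  apply: (konig T_lf) => nu nr; have [i [[i1 ei] _]] := piu nu nr.
  case: i i1 ei => // i _ /=; rewrite ray_edge // => ei.
  by exists i; apply/asboolP; rewrite ray_par.
pose U := undup [seq u <- lines (level T_lf N) | B u].
have U_neq u : u \in U -> u != root.
  by rewrite mem_undup mem_filter mem_lines => /and3P[].
have sumU : \sum_(u <- U) Psi lambda m u <= eps / 2.
  rewrite -lee_fin; apply/ltW/(le_lt_trans _ pisum); apply: esum_ge.
  exists [set` [seq (par u, u) | u <- U]].
    split; first exact: finite_seq.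
    move=> e /= /mapP[u]; rewrite mem_undup mem_filter => /andP[/asboolP pu _] ->.
    exact: pu.
  rewrite -fsbig_seq; last by rewrite map_inj_uniq ?undup_uniq // => u v [].
  by rewrite big_map /= sumEFin.
have [C HC] := expect_confined T_lf lambda_gt0 m_root T_infinite N.
pose n := (Num.truncn (C / (eps / 2))).+1; exists n.
have nC : C <= n%:R * (eps / 2) by rewrite -ler_pdivrMr //; exact/ltW/truncnS_gt.
have conf : expect n (fun h => (confined T_lf m N h)%:R) <= eps / 2.
  have n0 : 0 < n%:R :> R by rewrite ltr0n.
  by rewrite -(ler_pM2l n0); exact: le_trans (HC n) nC.
rewrite [leRHS](_ : _ = eps / 2 + eps / 2); last by field.
apply: le_trans (lerD conf sumU).
apply: (@le_trans _ _ (expect n (fun h => (confined T_lf m N h)%:R +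
    \sum_(u <- U) (dug (stopped h) u)%:R))).
  apply: (expect_le lambda_gt0 m_root) => h vh _.
  have s0 : 0 <= \sum_(u <- U) (dug (stopped h) u)%:R :> R by apply: sumr_ge0.
  have [rh|nrh] := boolP (returned h); first by rewrite addr_ge0.
  have [cf|ncf] := boolP (confined T_lf m N h); first by rewrite lerDl.
  rewrite add0r stopped_id //.
  move: ncf; rewrite /confined nrh /= => /allPn[v vN]; rewrite negbK => dv.
  have vN' : depth v = N by apply/eqP; rewrite -(mem_level T_lf).
  have /hasP[u] := NB v vN'; rewrite mem_line => /andP[ur uv] Bu.
  have uU : u \in U.
    by rewrite mem_undup mem_filter Bu mem_lines ur; apply/hasP; exists v.
  rewrite (big_rem u) //= (dug_anc vh dv uv) lerDl.
  exact: sumr_ge0.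
rewrite expectD // lerD2l expect_sum //.
rewrite big_seq [leRHS]big_seq; apply: ler_sum => u uU.
exact: (expect_dug_le T_lf lambda_gt0 m_root T_infinite n (U_neq u uU)).
Qed.

(** If the walk returned almost surely, level [k + 1] would be dug before the
    return with a probability bounded below uniformly in [k], although the
    probability of not having returned by time [k] tends to zero. *)
Lemma expect_not_returned_not_small : (1 < RT (psiM lambda m))%E ->
  (exists M : nat, forall nu : T, (m nu <= M)%N) ->
  ~ forall eps, 0 < eps -> exists n, expect n (fun h => (~~ returned h)%:R) <= eps.
Proof.
move=> RT1 [M mM] small; have [g [c [g1 c0 cpi]]] := RT_gt1 lambda_gt0 RT1.
have csup N : (0 < N)%N -> c <= supply T_lf (Psi_pow lambda m g) N.
  by move=> N0; apply: supply_cut.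
have [c1 c10 Hc1] := dig_deep lambda_gt0 m_root T_infinite g1 mM c0 csup.
have [|k Hk] := small (c1 / 2); first by rewrite divr_gt0.
have [eps eps0 He] := Hc1 k.+1 (ltn0Sn k).
have [n Hn] := small eps eps0.
have h1 := He _ (le_trans (expect_not_returned_antitone (leq_maxr k n)) Hn).
have := le_trans (le_trans h1 (expect_dug_level_le (leq_maxl k n))) Hk.
lra.
Qed.

End Dichotomy.

Section ContinuityFromAbove.
Import numFieldNormedType.Exports.

Lemma bigcap_null_small (R : realType) (d : measure_display)
    (Omega : measurableType d) (P : probability Omega R) (A : nat -> set Omega)
    (e : R) :
  (forall n, measurable (A n)) -> nonincreasing_seq A ->
  P (\bigcap_n A n) = 0%E -> 0 < e ->
  exists n0, forall n, (n0 <= n)%N -> fine (P (A n)) < e.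
Proof.
move=> mA niA P0 e0.
have A0 : (P (A 0%N) < +oo)%E by rewrite ltey_eq fin_num_measure.
have cvA : P (A n) @[n --> \oo] --> (0%:E : \bar R).
  have -> : (0%:E : \bar R) = P (\bigcap_n A n) by rewrite P0.
  exact: (nonincreasing_cvg_mu A0 mA (bigcapT_measurable mA) niA).
have cvp : fine (P (A n)) @[n --> \oo] --> (0 : R) by exact: fine_cvg cvA.
move/cvgrPdist_lt: cvp => /(_ e e0)[n0 _ H]; exists n0 => n nn.
by have := H n nn; rewrite /= sub0r normrN; apply: le_lt_trans; exact: ler_norm.
Qed.

End ContinuityFromAbove.

(** The event of no return is the decreasing intersection of the events of no
    return by time [n]. *)
Lemma recurrentP (R : realType) (T : rootedTree)
  (T_infinite : infinite_set [set: T]) (T_lf : locally_finite_tree T)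
  (lambda : R) (lambda_gt0 : 0 < lambda)
  (m : T -> nat) (m_root : m troot = 0%N)
  (d : measure_display) (Omega : measurableType d) (P : probability Omega R)
  (X : nat -> Omega -> T) (X_DRW : digging_random_walk lambda m P X) :
  recurrent m P X <-> forall eps, 0 < eps ->
    exists n, expect T_lf lambda m n (fun h => (~~ returned m h)%:R) <= eps.
Proof.
pose alive n := [set w | ~~ back m (past X n w)].
pose q n := expect T_lf lambda m n (fun h => (~~ returned m h)%:R).
have mA n : measurable (alive n).
  exact: (measurable_past_event T_lf X_DRW n [set h | ~~ back m h]).
have PA n : P (alive n) = (q n)%:E.
  rewrite -[LHS]fineK ?fin_num_measure //; congr (_%:E).
  rewrite (p_past_event T_lf lambda_gt0 m_root T_infinite X_DRW n (fun h => ~~ back m h)).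
  by apply: (expect_eq lambda_gt0 m_root) => h vh _; rewrite (back_valid vh).
have aliveE : [set w | return_time m (fun n => X n w) = None] = \bigcap_n alive n.
  apply/seteqP; split => w /=.
    by move/(return_time_None m_root) => nb n _; exact: nb.
  by move=> al; apply/(return_time_None m_root) => n; exact: al.
have mI : measurable (\bigcap_n alive n) by exact: bigcapT_measurable.
have niA : nonincreasing_seq alive.
  apply/nonincreasing_seqP => n; apply/subsetPset => w.
  by rewrite /alive /= negb_or => /andP[].
rewrite /recurrent /transient aliveE; split=> [/negP|small].
  rewrite -leNgt => le0 eps eps0.
  have P0 : P (\bigcap_n alive n) = 0%E by apply/eqP; rewrite eq_le le0 measure_ge0.
  have [n0 H] := bigcap_null_small mA niA P0 eps0.
  by exists n0; move: (H n0 (leqnn n0)); rewrite PA => /ltW.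
apply/negP; rewrite -leNgt; apply/lee_addgt0Pr => eps eps0; rewrite add0e.
have [n qn] := small eps eps0.
apply: (@le_trans _ _ (P (alive n))); last by rewrite PA lee_fin.
by apply: le_measure; rewrite ?inE //; exact: bigcap_inf.
Qed.

Theorem theorem7 (R : realType) (T : rootedTree)
  (T_infinite : infinite_set [set: T]) (T_lf : locally_finite_tree T)
  (lambda : R) (lambda_gt0 : 0 < lambda)
  (m : T -> nat) (m_root : m troot = 0%N)
  (d : measure_display) (Omega : measurableType d) (P : probability Omega R)
  (X : nat -> Omega -> T) (X_DRW : digging_random_walk lambda m P X) :
  ((RT (psiM lambda m) < 1)%E -> recurrent m P X) /\
  ((1 < RT (psiM lambda m))%E ->
     (exists M : nat, forall nu : T, (m nu <= M)%N) -> transient m P X).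
Proof.
have rP := recurrentP T_infinite T_lf lambda_gt0 m_root X_DRW.
split=> [RT1|RT1 mM].
  by apply/rP; exact: expect_not_returned_small.
apply: contrapT => /rP; exact: expect_not_returned_not_small.
Qed.
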